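(* Suppose $X$ is a subprojective separable Banach space, with the lattice structure given by an unconditional basis, and $1 \leq p < \infty$. Then $\widetilde{X(\ell_p)}$ is subprojective.
   Context: All Banach spaces are assumed infinite dimensional. A Banach space $X$ is subprojective if every closed infinite dimensional subspace $Y \subset X$ contains a closed infinite dimensional subspace $Z \subset Y$ that is complemented in $X$. The lattice structure on $X$ is the coordinatewise order with respect to the unconditional basis (with the norm being, up to equivalent renorming, a Banach lattice norm). For a Banach lattice $X$ and $1\leq p<\infty$, $\widetilde{X(\ell_p)}$ is the completion of the space of all finite sequences $(x_1,\ldots,x_n)$ with $x_i\in X$, equipped with the norm $\|(x_1,\ldots,x_n)\| = \|(\sum_i|x_i|^p)^{1/p}\|$, where $$\Big(\sum_i|x_i|^p\Big)^{1/p} = \sup\Big\{\Big|\sum_i\alpha_ix_i\Big| : \sum_i|\alpha_i|^{p'}\leq 1\Big\},\qquad \frac1p+\frac1{p'}=1$$ (for $p=1$ the constraint reads $\max_i|\alpha_i|\leq 1$), the supremum being taken in the lattice $X$. *)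

(* Defs.v *)
From HB Require Import structures.
From mathcomp Require Import all_boot all_order all_algebra.
From mathcomp Require Import all_classical all_reals all_analysis.

Set Implicit Arguments.
Unset Strict Implicit.
Unset Printing Implicit Defensive.

Import Order.TTheory GRing.Theory Num.Theory.
Import numFieldNormedType.Exports.

Local Open Scope classical_set_scope.
Local Open Scope ring_scope.

Definition linear_subspace (R : realType) (X : lmodType R) (Y : set X) : Prop :=
  Y 0 /\ forall (a : R) (x y : X), Y x -> Y y -> Y (a *: x + y).

Definition finitely_spanned (R : realType) (X : lmodType R) (Y : set X) : Prop :=
  exists (n : nat) (v : 'I_n -> X),
    forall y, Y y -> exists a : 'I_n -> R, y = \sum_(i < n) a i *: v i.

(* For a linear subspace Y: the dimension of Y is infinite. *)
Definition infinite_dim (R : realType) (X : lmodType R) (Y : set X) : Prop :=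
  ~ finitely_spanned Y.

Definition complemented (R : realType) (X : normedModType R) (Z : set X) : Prop :=
  exists P : {linear X -> X},
    [/\ continuous P, forall x, Z (P x) & forall z, Z z -> P z = z].

(* The first conjunct is the standing convention that Banach spaces are
   infinite dimensional. *)
Definition subprojective (R : realType) (X : completeNormedModType R) : Prop :=
  infinite_dim [set: X] /\
  forall Y : set X, closed Y -> linear_subspace Y -> infinite_dim Y ->
    exists Z : set X,
      [/\ Z `<=` Y, closed Z, linear_subspace Z, infinite_dim Z &
          complemented Z].

Definition separable (T : topologicalType) : Prop :=
  exists D : set T, countable D /\ dense D.

Definition expansion (R : realType) (X : normedModType R) (e : nat -> X)
    (x : X) (a : nat -> R) : Prop :=
  series (fun n => a n *: e n) @ \oo --> x.

Definition schauder_basis (R : realType) (X : normedModType R)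
    (e : nat -> X) : Prop :=
  forall x : X, exists! a : nat -> R, expansion e x a.

(* The coordinates of x in the Schauder basis e. *)
Definition coord (R : realType) (X : normedModType R) (e : nat -> X)
    (x : X) : nat -> R :=
  xget (fun=> 0) [set a | expansion e x a].

Definition unconditional_basis (R : realType) (X : normedModType R)
    (e : nat -> X) : Prop :=
  schauder_basis e /\
  forall (x : X) (s : nat -> nat), bijective s ->
    cvgn (series (fun n => coord e x (s n) *: e (s n))).

Definition basis_le (R : realType) (X : normedModType R) (e : nat -> X)
    (x y : X) : Prop :=
  forall n, coord e x n <= coord e y n.

Definition is_lattice_sup (R : realType) (X : normedModType R) (e : nat -> X)
    (A : set X) (s : X) : Prop :=
  (forall x, A x -> basis_le e x s) /\
  (forall t, (forall x, A x -> basis_le e x t) -> basis_le e s t).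

(* The least upper bound of A for the coordinatewise order; it is unique when
   it exists, and 0 is a junk value otherwise. *)
Definition lattice_sup (R : realType) (X : normedModType R) (e : nat -> X)
    (A : set X) : X :=
  xget 0 [set s | is_lattice_sup e A s].

Definition lattice_abs (R : realType) (X : normedModType R) (e : nat -> X)
    (x : X) : X :=
  lattice_sup e [set x; - x].

Definition equivalent_norm (R : realType) (X : normedModType R)
    (N : X -> R) : Prop :=
  [/\ forall x y, N (x + y) <= N x + N y,
      forall (a : R) x, N (a *: x) = `|a| * N x &
      exists c C : R, [/\ 0 < c, 0 < C &
        forall x, c * `|x| <= N x /\ N x <= C * `|x|]].

Definition lattice_norm (R : realType) (X : normedModType R) (e : nat -> X)
    (N : X -> R) : Prop :=
  forall x y, basis_le e (lattice_abs e x) (lattice_abs e y) -> N x <= N y.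

(* The unit ball of l_q^n, for 1 <= q <= +oo. *)
Definition lq_ball (R : realType) (q : \bar R) (n : nat)
    (a : 'I_n -> R) : Prop :=
  if q is r%:E then \sum_(i < n) `|a i| `^ r <= 1
  else forall i, `|a i| <= 1.

(* (sum_(i < n) |x_i|^p)^(1/p) *)
Definition lattice_lp (R : realType) (X : normedModType R) (e : nat -> X)
    (p : R) (n : nat) (x : 'I_n -> X) : X :=
  lattice_sup e [set lattice_abs e (\sum_(i < n) a i *: x i) |
                  a in lq_ball (hoelder_conjugate p%:E) (n := n)].

(* Finite sequences in X, a sequence being identified with its extensions by
   zeros, form the vector space of finitely supported functions nat -> X. *)
Definition vanishes_from (R : realType) (X : lmodType R) (x : nat -> X)
    (n : nat) : Prop :=
  forall i, (n <= i)%N -> x i = 0.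

Definition finitely_supported (R : realType) (X : lmodType R) :
    {pred nat -> X} :=
  fun x => `[< exists n, vanishes_from x n >].

Lemma finitely_supported_submod (R : realType) (X : lmodType R) :
  submod_closed (@finitely_supported R X).
Proof.
split; first by apply/asboolP; exists 0%N => i _.
move=> a x y /asboolP[m xm] /asboolP[n yn]; apply/asboolP.
exists (maxn m n) => i; rewrite geq_max => /andP[mi ni].
by rewrite !fctE xm // yn // scaler0 addr0.
Qed.

HB.instance Definition _ (R : realType) (X : lmodType R) :=
  GRing.isSubmodClosed.Build R (nat -> X) (@finitely_supported R X)
    (@finitely_supported_submod R X).

Record finseq (R : realType) (X : lmodType R) := FinSeq {
  finseq_val :> nat -> X;
  finseq_valP : finseq_val \in @finitely_supported R X }.

HB.instance Definition _ (R : realType) (X : lmodType R) :=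
  [isSub for @finseq_val R X].
HB.instance Definition _ (R : realType) (X : lmodType R) :=
  [Choice of finseq X by <:].
HB.instance Definition _ (R : realType) (X : lmodType R) :=
  [SubChoice_isSubLmodule of finseq X by <:].

(* A length for x; lattice_lp does not depend on the choice of the length,
   since it is unaffected by trailing zeros. *)
Definition finseq_length (R : realType) (X : lmodType R) (x : finseq X) : nat :=
  xget 0%N [set n | vanishes_from x n].

Definition Xlp_norm (R : realType) (X : normedModType R) (e : nat -> X)
    (N : X -> R) (p : R) (x : finseq X) : R :=
  N (lattice_lp e p (fun i : 'I_(finseq_length x) => x i)).

(* W is a completion of the vector space V for the norm nu. *)
Definition is_completion (R : realType) (V : lmodType R) (nu : V -> R)
    (W : completeNormedModType R) : Prop :=
  exists J : {linear V -> W}, (forall v, `|J v| = nu v) /\ dense (range J).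

(* Main.v *)
Require Import Defs.
From HB Require Import structures.
From mathcomp Require Import all_boot all_order all_algebra.
From mathcomp Require Import all_classical all_reals all_analysis.
From mathcomp Require Import ring lra.

Set Implicit Arguments.
Unset Strict Implicit.
Unset Printing Implicit Defensive.

Import Order.TTheory GRing.Theory Num.Theory.
Import numFieldNormedType.Exports.

Local Open Scope classical_set_scope.
Local Open Scope ring_scope.

(** The coordinates of an element of the completion W form a doubly indexed
array b, where b n i is the n-th coordinate, in the basis e of X, of the i-th
entry of the sequence; let E n i be the corresponding unit vectors. Finitely
supported arrays are dense in W, and the norm of such an array is the norm in
X of the vector whose n-th coordinate is the l_p norm of the n-th row
([norm_array], [array_dense]). So W is the X-sum of countably many copies of
l_p, and everything below is done with finite arrays and extended to W by
density.

Let Y be a closed infinite dimensional subspace of W, and let P_n be the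
restriction of arrays to the rows before n.

If no P_n is bounded below on Y, unit vectors of Y can be chosen with
arbitrarily small early rows, and a gliding hump ([gliding_hump]) gives
vectors y_k of Y which are small perturbations of unit vectors w_k supported
on successive blocks of rows. Normalizing the rows of the w_k and choosing
norming functionals for them gives operators j : X -> W and q : W -> X, both
acting row by row, such that w_k = j z_k and q j z_k = z_k for suitable z_k in
X. An isomorphism T of W onto its range, with a bounded left
inverse B, moves w_k to y_k ([small_perturbation]). The closed subspace of all
x with T j x in Y and q j x = x contains every z_k, so the subprojectivity of
X gives in it an infinite dimensional range of a projection P0 of X; then T j
P0 q B is a projection of W with infinite dimensional range inside Y
([complemented_late_rows]).

Otherwise some P_n is bounded below on Y. On finitely many rows the norm of W
is equivalent to the l_p norm of all entries ([first_rows_estimates]). Since Y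
is infinite dimensional, it has vectors whose first k columns vanish in these
rows, so the hump now glides along the columns of P_n(Y), and gives blocks w_k
close to P_n y_k with y_k in Y. As in l_p, the functionals biorthogonal to the
blocks define a bounded operator u |-> sum_k phi_k(u) y_k; composed with B P_n
it is a projection onto the closed span of the y_k
([complemented_early_rows]).

Biorthogonal functionals of norm one come from the Hahn-Banach theorem, and
the perturbation T from a Neumann series. *)

(** * Bounded operators and density *)

Section BoundedOperators.
Context {R : realType}.

Lemma linear_of_function (V W : lmodType R) (f : V -> W) :
  (forall a x y, f (a *: x + y) = a *: f x + f y) ->
  exists g : {linear V -> W}, forall x, g x = f x.
Proof.
move=> fl.
pose L := GRing.isLinear.Build R V W *:%R f fl.
pose g : {linear V -> W} := HB.pack f L.
by exists g.
Qed.

Lemma bounded_continuous (V W : normedModType R) (f : {linear V -> W}) (C : R) :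
  (forall x, `|f x| <= C * `|x|) -> continuous f.
Proof.
move=> fC; apply: bounded_linear_continuous; apply/linear_boundedP.
exists C; split=> [|r Cr x]; first exact: num_real.
by apply: (le_trans (fC x)); apply: ler_wpM2r => //; exact: ltW.
Qed.

Lemma continuous_bounded (V W : normedModType R) (f : {linear V -> W}) :
  continuous f -> exists2 C : R, 0 < C & forall x, `|f x| <= C * `|x|.
Proof.
move=> fc; have /linear_boundedP := continuous_linear_bounded 0 (fc 0).
move=> [M [Mr MP]]; exists (Num.max 1 (M + 1)).
  by rewrite lt_max ltr01.
by move=> x; apply: MP; rewrite lt_max ltrDl ltr01 orbT.
Qed.

Lemma dense_approx (V : normedModType R) (S : set V) : dense S ->
  forall x (d : R), 0 < d -> exists2 s, S s & `|x - s| < d.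
Proof.
move=> dS x d d0; have [|s [sb Ss]] := dS (ball x d) _ (ball_open x d).
  by exists x; exact: ballxx.
by exists s => //; rewrite -ball_normE in sb.
Qed.

Lemma approx_dense (V : normedModType R) (S : set V) :
  (forall x (d : R), 0 < d -> exists2 s, S s & `|x - s| < d) -> dense S.
Proof.
move=> SP O [x Ox] oO; have : nbhs x O by exact: open_nbhs_nbhs.
move=> /nbhs_ballP[d /= d0 dO]; have [s Ss xs] := SP x d d0.
by exists s; split=> //; apply: dO; rewrite -ball_normE.
Qed.

Lemma dense_closed (V : normedModType R) (S C : set V) :
  dense S -> closed C -> S `<=` C -> forall x, C x.
Proof.
move=> dS cC SC x; apply: cC => B /nbhs_ballP[d /= d0 dB].
have [s Ss xs] := dense_approx dS x d0.
by exists s; split; [exact: SC|apply: dB; rewrite -ball_normE].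
Qed.

Lemma closed_coincidence (V W : normedModType R) (f g : {linear V -> W}) :
  continuous f -> continuous g -> closed [set x | f x = g x].
Proof.
move=> fc gc.
have -> : [set x | f x = g x] = (fun x => `|f x - g x|) @^-1` [set x : R | x = 0].
  apply/seteqP; split=> x /=; first by move=> ->; rewrite subrr normr0.
  by move=> /normr0_eq0/subr0_eq.
apply: preimage_closed; last exact: closed_eq.
move=> x _; apply: cvg_norm; apply: cvgB; [exact: fc|exact: gc].
Qed.

Lemma dense_eq (V W : normedModType R) (S : set V) (f g : {linear V -> W}) :
  dense S -> continuous f -> continuous g -> (forall x, S x -> f x = g x) ->
  forall x, f x = g x.
Proof.
by move=> dS fc gc fg; apply: (dense_closed dS (closed_coincidence fc gc)).
Qed.

(** Extension by density, for an operator given by its graph G: a bound on the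
graph makes it single valued, so operators can be prescribed on the
expressions that define the elements of a dense subspace, with no need to
check that the values depend only on the elements. *)
Lemma extend_dense (U : normedModType R) (V : completeNormedModType R)
    (G : set (U * V)) (C : R) : 0 <= C ->
  linear_subspace G ->
  (forall x y, G (x, y) -> `|y| <= C * `|x|) ->
  dense [set x | exists y, G (x, y)] ->
  exists A : {linear U -> V}, (forall x, `|A x| <= C * `|x|) /\
    forall x y, G (x, y) -> A x = y.
Proof.
move=> C0 [G0 Glin] GC Gd.
(* H is the closure of G *)
pose H x y := forall d : R, 0 < d ->
  exists x' y', [/\ G (x', y'), `|x - x'| < d & `|y - y'| < d].
have HG x y : G (x, y) -> H x y.
  by move=> Gxy d d0; exists x, y; rewrite !subrr !normr0.
have HC x y : H x y -> `|y| <= C * `|x|.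
  move=> Hxy; apply/ler_addgt0Pr => d d0.
  have C2 : 0 < C + 1 by rewrite ltr_pwDr.
  have [x' [y' [Gxy xx yy]]] := Hxy (d / (C + 1)) (divr_gt0 d0 C2).
  have -> : y = y' + (y - y') by rewrite addrC subrK.
  apply: (le_trans (ler_normD _ _)).
  have x'x : `|x'| <= `|x| + d / (C + 1).
    have -> : x' = x - (x - x') by rewrite opprB addrC subrK.
    by rewrite (le_trans (ler_normB _ _))// lerD2l ltW.
  have h : `|y'| <= C * (`|x| + d / (C + 1)).
    by rewrite (le_trans (GC _ _ Gxy))// ler_wpM2l.
  have e : C * (d / (C + 1)) + d / (C + 1) = d by field; lra.
  rewrite mulrDr in h; lra.
have Hlin a x y x' y' : H x y -> H x' y' -> H (a *: x + x') (a *: y + y').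
  move=> h h' d d0; have a0 : 0 < 2 * (`|a| + 1).
    by rewrite mulr_gt0// ltr_pwDr.
  have [u [v [Guv xu yv]]] := h _ (divr_gt0 d0 a0).
  have [u' [v' [Guv' xu' yv']]] := h' (d / 2) (divr_gt0 d0 (ltr0Sn _ 1)).
  exists (a *: u + u'), (a *: v + v'); split; first exact: (Glin a _ _ Guv Guv').
  - have -> : a *: x + x' - (a *: u + u') = a *: (x - u) + (x' - u').
      by rewrite scalerBr opprD addrACA.
    apply: (le_lt_trans (ler_normD _ _)); rewrite normrZ.
    have h1 : `|a| * `|x - u| <= (`|a| + 1) * (d / (2 * (`|a| + 1))).
      by rewrite ler_pM// ?ltW// ?ltrDl.
    have e : (`|a| + 1) * (d / (2 * (`|a| + 1))) = d / 2 by field; lra.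
    rewrite e in h1; lra.
  - have -> : a *: y + y' - (a *: v + v') = a *: (y - v) + (y' - v').
      by rewrite scalerBr opprD addrACA.
    apply: (le_lt_trans (ler_normD _ _)); rewrite normrZ.
    have h1 : `|a| * `|y - v| <= (`|a| + 1) * (d / (2 * (`|a| + 1))).
      by rewrite ler_pM// ?ltW// ?ltrDl.
    have e : (`|a| + 1) * (d / (2 * (`|a| + 1))) = d / 2 by field; lra.
    rewrite e in h1; lra.
have Huniq x y y' : H x y -> H x y' -> y = y'.
  move=> h h'; apply/eqP; rewrite -subr_eq0 -normr_le0.
  have := HC _ _ (Hlin (-1) _ _ _ _ h' h).
  by rewrite !scaleN1r addNr normr0 mulr0 addrC.
have Hex x : exists y, H x y.
  have /choice[uv uvP] : forall n, exists uv : U * V,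
      G uv /\ `|x - uv.1| < n.+1%:R^-1.
    move=> n; have n0 : 0 < n.+1%:R^-1 :> R by rewrite invr_gt0.
    by have [u [v Guv] xu] := dense_approx Gd x n0; exists (u, v).
  pose v n := (uv n).2.
  have small d : 0 < d -> exists N, forall n, (N <= n)%N -> n.+1%:R^-1 < d :> R.
    move=> d0; exists (Num.truncn d^-1) => n Nn.
    rewrite -[ltRHS]invrK ltf_pV2 ?posrE ?invr_gt0//.
    rewrite (lt_le_trans (truncnS_gt _))// ler_nat//.
  have vC n m : `|v n - v m| <= C * (n.+1%:R^-1 + m.+1%:R^-1).
    have [[Gn xn] [Gm xm]] := (uvP n, uvP m).
    have := Glin (-1) _ _ Gm Gn; rewrite [uv n]surjective_pairing.
    rewrite [uv m]surjective_pairing => /GC; rewrite !scaleN1r.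
    rewrite addrC => h; apply: (le_trans h); apply: ler_wpM2l => //.
    have -> : - (uv m).1 + (uv n).1 = (x - (uv m).1) - (x - (uv n).1).
      by rewrite [RHS]addrC opprB addrA subrK addrC.
    by rewrite (le_trans (ler_normB _ _))// addrC lerD// ltW.
  have vcvg : cvg (v @ \oo).
    apply: cauchy_cvg; apply: cauchy_exP => d d0.
    have C2 : 0 < 2 * (C + 1) by rewrite mulr_gt0// ltr_pwDr.
    have [N NP] := small _ (divr_gt0 d0 C2).
    exists (v N); exists N => // n /= Nn; rewrite -ball_normE /=.
    apply: (le_lt_trans (vC N n)).
    have h1 := NP N (leqnn N); have h2 := NP n Nn.
    have e : (C + 1) * (d / (2 * (C + 1)) + d / (2 * (C + 1))) = d.
      by field; lra.
    rewrite -e; apply: (@le_lt_trans _ _ ((C + 1) * (N.+1%:R^-1 + n.+1%:R^-1))).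
      by rewrite ler_wpM2r// ?lerDl// addr_ge0.
    by rewrite ltr_pM2l; [exact: ltrD|rewrite ltr_pwDr].
  exists (lim (v @ \oo)) => d d0.
  have := vcvg; move=> /cvgrPdist_lt /(_ d d0) [N1 _ N1P].
  have [N2 N2P] := small _ d0.
  pose n := maxn N1 N2.
  exists (uv n).1, (uv n).2; rewrite -surjective_pairing; split.
  - by have [] := uvP n.
  - by have [_ h] := uvP n; rewrite (lt_trans h)// N2P// leq_maxr.
  - by apply: (N1P n) => /=; rewrite leq_maxl.
have /choice[f fP] := Hex.
have [A AP] : exists g : {linear U -> V}, forall x, g x = f x.
  by apply: linear_of_function => a x y; apply: (Huniq (a *: x + y)) => //; exact: Hlin.
exists A; split=> [x|x y Gxy]; first by rewrite AP; exact: HC.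
by rewrite AP; apply: (Huniq x) => //; exact: HG.
Qed.

End BoundedOperators.

(** * Functionals and perturbations *)

(** The Hahn-Banach theorem, with Zorn's lemma applied to linear relations r
<= |x| containing the line through (w, |w|). A maximal one is the graph of a
functional. *)
Lemma hahn_banach_norming (R : realType) (V : normedModType R) (w : V) :
  exists f : {linear V -> R^o}, (forall x, `|f x| <= `|x|) /\ f w = `|w|.
Proof.
pose Q (G : set (V * R^o)) := [/\ linear_subspace G,
  forall x r, G (x, r) -> r <= `|x| & G (w, `|w|)].
(* the empty set is admitted because the union of an empty chain is empty *)
pose P G := G = set0 \/ Q G.
have line : Q [set xr | exists t, xr = (t *: w, t * `|w|)].
  split=> [|x r [t [-> ->]]|]; last by exists 1; rewrite scale1r mul1r.
    split; first by exists 0; rewrite scale0r mul0r.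
    move=> a _ _ [t ->] [s ->]; exists (a * t + s).
    by rewrite scalerDl mulrDl -scalerA -mulrA.
  by rewrite normrZ ler_wpM2r// ler_norm.
have [F FP totF|A [[A0|QA] Amax]] := @Zorn_bigcup _ P.
- have [[X FX QX]|noQ] := pselect (exists2 X, F X & Q X); last first.
    left; apply/seteqP; split=> // xr [X FX Xxr].
    have [X0|QX] := FP _ FX; first by rewrite X0 in Xxr.
    by case: noQ; exists X.
  right; have [[X0 _] _ Xw] := QX; split; last by exists X.
  + split; first by exists X.
    have up Y Z x y : F Y -> F Z -> Y x -> Z y -> exists2 T, F T & T x /\ T y.
      move=> FY FZ Yx Zy; have [YZ|ZY] := totF _ _ FY FZ.
        by exists Z => //; split=> //; exact: YZ.
      by exists Y => //; split=> //; exact: ZY.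
    move=> a x y [Y FY Yx] [Z FZ Zy]; have [T FT [Tx Ty]] := up _ _ _ _ FY FZ Yx Zy.
    exists T => //; have [T0|[[_ Tl] _ _]] := FP _ FT; first by rewrite T0 in Tx.
    exact: Tl.
  + move=> x r [Y FY Yx]; have [Y0|[_ Yb _]] := FP _ FY; first by rewrite Y0 in Yx.
    exact: Yb.
- exfalso; apply: (Amax _ _ (or_intror line)); rewrite A0.
  split; first by move=> ?.
  by move=> /(_ (1 *: w, 1 * `|w|)); apply; exists 1.
have [[A0 Al] Ab Aw] := QA.
have Atot x0 : exists r, A (x0, r).
  apply: contrapT => nx0.
  have gap x r x' r' : A (x, r) -> A (x', r') -> r - `|x - x0| <= `|x' + x0| - r'.
    move=> h h'; rewrite lerBlDr addrAC lerBrDr.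
    have := Ab _ _ (Al 1 _ _ h h'); rewrite !scale1r => h2; apply: (le_trans h2).
    have -> : x + x' = (x' + x0) + (x - x0) by rewrite addrACA subrr addr0 addrC.
    exact: ler_normD.
  pose S := [set s | exists x r, A (x, r) /\ s = r - `|x - x0|].
  have S0 : S !=set0 by exists (0 - `|0 - x0|), 0, 0.
  have Sub x' r' : A (x', r') -> ubound S (`|x' + x0| - r').
    by move=> h' s [x [r [h ->]]]; exact: gap.
  (* a is an admissible value at x0 for an extension of the relation *)
  pose a := sup S.
  have a1 x r : A (x, r) -> r - `|x - x0| <= a.
    move=> h; apply: ub_le_sup; last by exists x, r.
    by exists (`|0 + x0| - 0); exact: Sub.
  have a2 x r : A (x, r) -> a <= `|x + x0| - r.
    by move=> h; apply: ge_sup => //; exact: Sub.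
  pose G := [set z | exists x r t, A (x, r) /\ z = (x + t *: x0, r + t * a)].
  have AG : A `<=` G.
    by move=> [x r] h; exists x, r, 0; rewrite scale0r mul0r !addr0.
  have QG : Q G.
    split; last exact: AG.
    + split; first exact: AG.
      move=> b _ _ [x [r [t [h ->]]]] [x' [r' [t' [h' ->]]]].
      exists (b *: x + x'), (b *: r + r'), (b * t + t'); split; first exact: (Al b _ _ h h').
      have -> : b *: (x + t *: x0, r + t * a) + (x' + t' *: x0, r' + t' * a)
        = (b *: (x + t *: x0) + (x' + t' *: x0), b * (r + t * a) + (r' + t' * a)) by [].
      rewrite scalerDr scalerDl scalerA addrACA; congr (_, _).
      by rewrite /GRing.scale/=; ring.
    + move=> _ _ [x [r [t [h [-> ->]]]]].
      have [t0|t0|->] := ltrgtP t 0.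
      * have h1 := Al (- t^-1) _ _ h A0.
        rewrite addr0 in h1.
        have /a1 := h1; rewrite /GRing.scale/= => h2.
        have e : `|x + t *: x0| = - t * `|- t^-1 *: x - x0|.
          rewrite -[X in _ = X * _](ltr0_norm t0) -normrZ scalerBr scalerA mulrN mulfV ?lt_eqF//.
          rewrite scaleN1r -opprD normrN //.
        rewrite e; have t0' : 0 < - t by rewrite oppr_gt0.
        have := ler_wpM2l (ltW t0') h2.
        have -> : - t * (- t^-1 * r - `|- t^-1 *: x - x0|) = r + t * `|- t^-1 *: x - x0|.
          by rewrite mulrBr mulrA mulrNN mulfV ?lt_eqF// mul1r mulNr opprK.
        by rewrite !mulNr => h3; lra.
      * have h1 := Al (t^-1) _ _ h A0.
        rewrite addr0 in h1.
        have /a2 := h1; rewrite /GRing.scale/= => h2.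
        have e : `|x + t *: x0| = t * `|t^-1 *: x + x0|.
          rewrite -[X in _ = X * _](gtr0_norm t0) -normrZ scalerDr scalerA mulfV ?gt_eqF//.
          by rewrite scale1r.
        rewrite e.
        have := ler_wpM2l (ltW t0) h2.
        have -> : t * (`|t^-1 *: x + x0| - t^-1 * r) = t * `|t^-1 *: x + x0| - r.
          by rewrite mulrBr mulrA mulfV ?gt_eqF// mul1r.
        by move=> h3; lra.
      * by rewrite scale0r mul0r !addr0; exact: Ab.
  apply: (Amax G); last by right.
  split=> // GA; apply: nx0; exists a; apply: GA.
  by exists 0, 0, 1; rewrite scale1r mul1r !add0r.
have Auniq x r r' : A (x, r) -> A (x, r') -> r = r'.
  have le s s' : A (x, s) -> A (x, s') -> s <= s'.
    move=> h h'; have := Ab _ _ (Al (-1) _ _ h' h).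
    by rewrite !scaleN1r addNr normr0 addrC subr_le0.
  by move=> h h'; apply/eqP; rewrite eq_le !le.
have /choice[f fP] := Atot.
have [g gP] : exists g : {linear V -> R^o}, forall x, g x = f x.
  apply: linear_of_function => b x y; apply: (Auniq (b *: x + y)) => //; exact: (Al b _ _ (fP x) (fP y)).
exists g; split=> [x|]; last by rewrite gP; exact: (Auniq w).
rewrite ler_norml; apply/andP; split; last by rewrite gP; exact: Ab.
rewrite lerNl -linearN -[leRHS]normrN gP; exact: Ab.
Qed.

Section OperatorSeries.
Context {R : realType} {V : normedModType R} {W : completeNormedModType R}.

Lemma operator_series (A : nat -> V -> W) (c : nat -> R) (S : R) :
  (forall k a x y, A k (a *: x + y) = a *: A k x + A k y) ->
  (forall k x, `|A k x| <= c k * `|x|) ->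
  (forall n, \sum_(0 <= k < n) c k <= S) ->
  exists B : {linear V -> W},
    (forall x, series (fun k => A k x) @ \oo --> B x) /\
    forall x, `|B x| <= S * `|x|.
Proof.
move=> Alin Ac cS.
have partial x n : [normed series (fun k => A k x)] n <= S * `|x|.
  rewrite /series /=; apply: (@le_trans _ _ (\sum_(0 <= k < n) c k * `|x|)).
    by apply: ler_sum => k _.
  by rewrite -mulr_suml ler_wpM2r.
have ncv x : cvgn [normed series (fun k => A k x)].
  apply: nondecreasing_is_cvgn.
    by apply/nondecreasing_seqP => n; rewrite -subr_ge0 seriesSB normr_ge0.
  by exists (S * `|x|) => _ [n _ <-]; exact: partial.
have cv x : cvgn (series (fun k => A k x)) by exact: normed_cvg.
have [B BP] : exists B : {linear V -> W}, forall x, B x = limn (series (fun k => A k x)).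
  apply: linear_of_function => a x y; apply/cvg_lim => //.
  have -> : series (fun k => A k (a *: x + y)) =
      (fun n => a *: series (fun k => A k x) n + series (fun k => A k y) n).
    apply/funext => n; rewrite /series /= scaler_sumr -big_split /=.
    by apply: eq_bigr => k _; rewrite Alin.
  by apply: cvgD; [apply: cvgZr|]; exact: cv.
exists B; split=> [x|x]; first by rewrite BP; exact: cv.
rewrite BP; apply: (le_trans (lim_series_norm (ncv x))).
by apply: limr_le => //; apply: nearW => n; exact: partial.
Qed.

End OperatorSeries.

Lemma half_geometric (R : realType) n :
  \sum_(0 <= k < n) (2^-1) ^+ k.+1 = 1 - (2^-1) ^+ n :> R.
Proof.
elim: n => [|n IH]; first by rewrite big_nil expr0 subrr.
by rewrite big_nat_recr//= IH !exprS; field.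
Qed.

(** B is the Neumann series sum_k (1 - T)^k, and B T = 1 by telescoping. *)
Lemma neumann_left_inverse (R : realType) (V : completeNormedModType R)
    (T : {linear V -> V}) : (forall x, `|T x - x| <= 2^-1 * `|x|) ->
  exists B : {linear V -> V}, continuous B /\ forall x, B (T x) = x.
Proof.
move=> TE; pose N x := x - T x.
have NE x : `|N x| <= 2^-1 * `|x| by rewrite /N distrC.
have Nlin a x y : N (a *: x + y) = a *: N x + N y.
  by rewrite /N linearP scalerBr opprD addrACA.
have iterE k x : `|iter k N x| <= (2^-1) ^+ k * `|x|.
  elim: k => [|k IH]; first by rewrite expr0 mul1r.
  rewrite iterS (le_trans (NE _))// exprS -mulrA ler_wpM2l//.
have [B [BS BC]] : exists B : {linear V -> V},
    (forall x, series (fun k => iter k N x) @ \oo --> B x) /\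
    forall x, `|B x| <= 2 * `|x|.
  apply: (@operator_series _ _ _ _ (fun k => (2^-1) ^+ k)) => [k a x y|//|n].
    by elim: k => [//|k IH]; rewrite !iterS IH Nlin.
  have := half_geometric R n; under eq_bigr do rewrite exprS.
  rewrite -mulr_sumr => h; have h2 : 0 <= 2^-1 ^+ n :> R by rewrite exprn_ge0.
  lra.
exists B; split; first exact: bounded_continuous BC.
move=> x; apply: (norm_cvg_unique (BS (T x))).
rewrite /mkset.
have -> : series (fun k => iter k N (T x)) = (fun n => x - iter n N x).
  apply/funext => n; rewrite /series /=; elim: n => [|n IH].
    by rewrite big_nil subrr.
  rewrite big_nat_recr//= IH.
  have iterB k u v : iter k N (u - v) = iter k N u - iter k N v.
    by elim: k => [//|k IHk]; rewrite !iterS IHk /N linearB !opprD !opprK addrACA.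
  have -> : iter n N (T x) = iter n N x - N (iter n N x).
    by rewrite -iterS iterSr -iterB /N subKr.
  by rewrite addrA subrK.
suff N0 : (fun n => iter n N x) @ \oo --> (0 : V).
  have h : (fun n => x - iter n N x) @ \oo --> x - 0 by apply: cvgB => //; exact: cvg_cst.
  by rewrite subr0 in h.
apply/norm_cvg0P.
apply: (@squeeze_cvgr _ _ _ _ (fun=> 0) (fun k => (2^-1) ^+ k * `|x|)).
- by apply: nearW => n; rewrite normr_ge0 iterE.
- exact: cvg_cst.
- have : `|2^-1 : R| < 1 by rewrite ger0_norm//; lra.
  move=> /cvg_expr h0.
  have h : (fun k => (2^-1) ^+ k * `|x|) @ \oo --> 0 * `|x| by exact: cvgMl.
  by rewrite mul0r in h.
Qed.

(** The principle of small perturbations: T is the identity plus the operator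
x |-> sum_k phi_k(x) (y_k - w_k), whose norm is at most 1/4 + 1/8 + ... = 1/2. *)
Lemma small_perturbation (R : realType) (V : completeNormedModType R)
    (phi : nat -> {linear V -> R^o}) (w y : nat -> V) :
  (forall k x, `|phi k x| <= `|x|) ->
  (forall j k, phi j (w k) = (j == k)%:R) ->
  (forall k, `|y k - w k| <= (2^-1) ^+ k.+2) ->
  exists T B : {linear V -> V}, [/\ forall x, `|T x| <= 2 * `|x|,
    continuous B, forall x, B (T x) = x & forall k, T (w k) = y k].
Proof.
move=> phib biorth close.
have [E [ES EC]] : exists E : {linear V -> V},
    (forall x, series (fun k => phi k x *: (y k - w k)) @ \oo --> E x) /\
    forall x, `|E x| <= 2^-1 * `|x|.
  apply: (@operator_series _ _ _ _ (fun k => (2^-1) ^+ k.+2)) => [k a x z|k x|n].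
  - by rewrite linearP scalerDl scalerA.
  - by rewrite normrZ mulrC ler_pM.
  - have := half_geometric R n.
    under [X in _ -> X <= _]eq_bigr do rewrite exprS.
    rewrite -mulr_sumr => ->.
    have : 0 <= 2^-1 ^+ n :> R by rewrite exprn_ge0.
    lra.
have [T TE] : exists T : {linear V -> V}, forall x, T x = x + E x.
  by apply: linear_of_function => a x z; rewrite linearP scalerDr addrACA.
have [B [Bc BT]] : exists B : {linear V -> V}, continuous B /\ forall x, B (T x) = x.
  by apply: neumann_left_inverse => x; rewrite TE addrC addKr.
exists T, B; split=> // [x|k].
  rewrite TE (le_trans (ler_normD _ _))//; have := EC x; have := normr_ge0 x; lra.
rewrite TE; suff -> : E (w k) = y k - w k by rewrite addrC subrK.
apply: (norm_cvg_unique (ES (w k))).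
rewrite /mkset.
apply: cvg_near_cst; exists k.+1 => // n /= kn.
rewrite /series /= (bigD1_seq k) /=; last 2 first.
  by rewrite mem_index_iota.
  exact: iota_uniq.
rewrite biorth eqxx scale1r big1 ?addr0// => j jk.
by rewrite biorth (negbTE jk) scale0r.
Qed.

(** * Infinite dimensional subspaces *)

Lemma finitely_spanned_image (R : realType) (V W : lmodType R)
    (A : {linear V -> W}) (Y : set V) :
  finitely_spanned Y -> finitely_spanned (A @` Y).
Proof.
move=> [n [v vP]]; exists n, (A \o v) => _ [y Yy <-].
have [a ->] := vP _ Yy; exists a; rewrite linear_sum.
by apply: eq_bigr => i _; rewrite linearZ.
Qed.

(** If n vectors spanned Y, the coefficients of w_0, ..., w_n would be n + 1
rows of length n, hence linearly dependent; the functionals exclude this. *)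
Lemma infinite_dim_biorthogonal (R : realType) (V : lmodType R) (Y : set V)
    (w : nat -> V) (phi : nat -> {linear V -> R^o}) :
  (forall k, Y (w k)) -> (forall j k, phi j (w k) = (j == k)%:R) ->
  infinite_dim Y.
Proof.
move=> Yw biorth [n [v vP]].
have /choice[a aP] : forall k : 'I_n.+1, exists a : 'I_n -> R,
    w k = \sum_(i < n) a i *: v i by move=> k; apply: vP; exact: Yw.
pose A := \matrix_(k < n.+1, i < n) a k i.
have : kermx A != 0.
  rewrite kermx_eq0 /row_free; apply/eqP => rA.
  by have := rank_leq_col A; rewrite rA ltnn.
move=> /rowV0Pn[c /sub_kermxP cA /negP]; apply; apply/eqP/rowP => j.
have c0 : \sum_(k < n.+1) c 0 k *: w k = 0.
  under eq_bigr => k _ do rewrite aP scaler_sumr.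
  rewrite exchange_big /= big1// => i _.
  under eq_bigr => k _ do rewrite scalerA.
  rewrite -scaler_suml; have /matrixP/(_ 0 i) := cA; rewrite !mxE => e.
  suff -> : \sum_k c 0 k * a k i = 0 by rewrite scale0r.
  by rewrite -[RHS]e; apply: eq_bigr => k _; rewrite !mxE.
have : phi j (\sum_(k < n.+1) c 0 k *: w k) = 0 by rewrite c0 linear0.
rewrite linear_sum (bigD1 j)//= linearZ /= biorth eqxx big1 => [|k kj].
  by rewrite addr0 mxE /GRing.scale /= mulr1.
by rewrite linearZ /= biorth -val_eqE eq_sym in kj *; rewrite (negbTE kj) scaler0.
Qed.

(** Each functional lowers the dimension of a subspace by at most one, so the
common kernel of n functionals on Y is still infinite dimensional. *)
Lemma infinite_dim_kernel (R : realType) (V : lmodType R) (Y : set V)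
    (phi : nat -> {linear V -> R^o}) (n : nat) :
  linear_subspace Y -> infinite_dim Y ->
  exists2 y, Y y & y != 0 /\ forall k, (k < n)%N -> phi k y = 0.
Proof.
move=> [Y0 Ylin] Yinf.
pose K n := [set y | Y y /\ forall k, (k < n)%N -> phi k y = 0].
suff Kinf : infinite_dim (K n).
  apply: contrapT => none; apply: Kinf; exists 0%N, (fun=> 0) => y [Yy y0].
  exists (fun=> 0); rewrite big_ord0; apply/eqP; apply: contrapT => /negP yn0.
  by apply: none; exists y.
elim: n => [|n IH]; first by move=> [m [v vP]]; apply: Yinf; exists m, v => y Yy; exact: vP.
move=> [m [v vP]]; apply: IH.
have [[u [[Yu u0] pu]]|no] := pselect (exists u, K n u /\ phi n u != 0); last first.
  exists m, v => y [Yy y0]; apply: vP; split=> // k; rewrite ltnS leq_eqVlt.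
  move=> /orP[/eqP ->|]; last exact: y0.
  by apply/eqP; apply: contrapT => /negP h; apply: no; exists y.
exists m.+1, (fun i => oapp v u (unlift ord0 i)) => y [Yy y0].
pose t := phi n y / phi n u.
have [|a aP] := vP (y - t *: u).
  split=> [|k]; first by rewrite addrC -scaleNr; exact: Ylin.
  rewrite ltnS leq_eqVlt linearB linearZ => /orP[/eqP ->|kn].
    by rewrite [X in _ - X](_ : _ = phi n y) ?subrr//; exact: mulfVK.
  by rewrite y0// u0//= scaler0 subr0.
exists (fun i => oapp a t (unlift ord0 i)).
rewrite big_ord_recl unlift_none /=; under eq_bigr => i _ do rewrite liftK /=.
by rewrite -aP addrC subrK.
Qed.

Lemma complemented_of_projection (R : realType) (W : completeNormedModType R)
    (Y : set W) (Pi : {linear W -> W}) :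
  continuous Pi -> (forall x, Pi (Pi x) = Pi x) -> (forall x, Y (Pi x)) ->
  infinite_dim (range Pi) ->
  exists Z : set W,
      [/\ Z `<=` Y, closed Z, linear_subspace Z, infinite_dim Z &
          complemented Z].
Proof.
move=> Pc PP PY Pinf; exists (range Pi).
have PE : range Pi = [set x | Pi x = x].
  by apply/seteqP; split=> [_ [x _ <-]|x Px]; [exact: PP|exists x].
split=> //.
- by move=> _ [x _ <-]; exact: PY.
- by rewrite PE; apply: (@closed_coincidence _ _ _ Pi idfun) => // x; exact: cvg_id.
- rewrite PE; split; first by rewrite /mkset linear0.
  by move=> a x y; rewrite /mkset linearP => -> ->.
- by exists Pi; split=> // _ [x _ <-]; exact: PP.
Qed.

(** * Duality for finite l_p norms *)

Section FiniteLp.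
Context {R : realType} (p : R) (p1 : 1 <= p).

Definition lp_norm (m : nat) (a : nat -> R) : R :=
  (\sum_(i < m) `|a i| `^ p) `^ p^-1.

Let p0 : 0 < p. Proof. exact: lt_le_trans p1. Qed.
Let pn0 : p != 0. Proof. by rewrite gt_eqF. Qed.

Lemma lp_norm_ge0 m a : 0 <= lp_norm m a.
Proof. exact: powR_ge0. Qed.

Lemma normr_lp_norm m a : `|lp_norm m a| = lp_norm m a.
Proof. by rewrite ger0_norm// lp_norm_ge0. Qed.

Lemma lp_normX m a : lp_norm m a `^ p = \sum_(i < m) `|a i| `^ p.
Proof.
by rewrite /lp_norm -powRrM mulVf// powRr1// sumr_ge0// => i _; exact: powR_ge0.
Qed.

Lemma powRK (x : R) : 0 <= x -> (x `^ p) `^ p^-1 = x.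
Proof. by move=> x0; rewrite -powRrM mulfV// powRr1. Qed.

Lemma powRpK (x : R) : 0 <= x -> (x `^ p^-1) `^ p = x.
Proof. by move=> x0; rewrite -powRrM mulVf// powRr1. Qed.

Lemma lp_norm_unique m (a : nat -> R) r : 0 <= r -> r `^ p = \sum_(i < m) `|a i| `^ p ->
  lp_norm m a = r.
Proof. by move=> r0 rp; rewrite /lp_norm -rp powRK. Qed.

Lemma le_powR (x y : R) : 0 <= x -> 0 <= y -> (x `^ p <= y `^ p) = (x <= y).
Proof.
move=> x0 y0; have [xy|yx] := leP x y.
  by apply: ge0_ler_powR => //; rewrite ltW.
by apply/negbTE; rewrite -ltNge; exact: gt0_ltr_powR.
Qed.

Lemma le_lp_norm m a i : (i < m)%N -> `|a i| <= lp_norm m a.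
Proof.
move=> im; rewrite -(le_powR _ (lp_norm_ge0 m a))// lp_normX.
rewrite (bigD1 (Ordinal im))//= lerDl sumr_ge0// => j _; exact: powR_ge0.
Qed.

Lemma lp_normZ m t a : lp_norm m (fun i => t * a i) = `|t| * lp_norm m a.
Proof.
apply: lp_norm_unique; first by rewrite mulr_ge0// lp_norm_ge0.
rewrite (powRM p (normr_ge0 t) (lp_norm_ge0 m a)) lp_normX mulr_sumr.
by apply: eq_bigr => i _; rewrite normrM powRM.
Qed.

Lemma eq_lp_norm m a b : (forall i, (i < m)%N -> `|a i| = `|b i|) ->
  lp_norm m a = lp_norm m b.
Proof. by move=> ab; congr (_ `^ _); apply: eq_bigr => i _; rewrite ab. Qed.

Lemma ler_lp_norm m a b : (forall i, (i < m)%N -> `|a i| <= `|b i|) ->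
  lp_norm m a <= lp_norm m b.
Proof.
have S0 (c : nat -> R) : 0 <= \sum_(i < m) `|c i| `^ p.
  by apply: sumr_ge0 => i _; exact: powR_ge0.
move=> ab; apply: ge0_ler_powR; [by rewrite invr_ge0 ltW|exact: S0|exact: S0|].
by apply: ler_sum => i _; rewrite le_powR// ab.
Qed.

Lemma lp_norm_widen m m' a : (m <= m')%N ->
  (forall i, (m <= i)%N -> a i = 0) -> lp_norm m' a = lp_norm m a.
Proof.
move=> mm' a0; congr (_ `^ _); rewrite (big_ord_widen _ (fun i => `|a i| `^ p) mm').
rewrite [LHS](bigID (fun i : 'I_m' => (i < m)%N)) /= [X in _ + X]big1 ?addr0// => i.
by rewrite -leqNgt => /a0 ->; rewrite normr0 powR0.
Qed.

Lemma lp_norm0 m : lp_norm m (fun=> 0) = 0.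
Proof.
apply: lp_norm_unique => //; rewrite powR0// big1// => i _.
by rewrite normr0 powR0.
Qed.

Lemma hoelder_conjugate_fin : 1 < p ->
  hoelder_conjugate p%:E = (p / (p - 1))%:E.
Proof.
move=> p11; have p10 : p - 1 != 0 by rewrite subr_eq0 gt_eqF.
have pE0 : (p%:E == 0%E :> \bar R) = false by rewrite eqe (negbTE pn0).
by rewrite /hoelder_conjugate /= pE0 -EFinB inver (negbTE p10) -EFinM.
Qed.

(** Hoelder's inequality, from Young's inequality applied to b normalized. *)
Lemma lq_ball_hoelder m (al : 'I_m -> R) (b : nat -> R) :
  lq_ball (hoelder_conjugate p%:E) al ->
  `|\sum_(i < m) al i * b i| <= lp_norm m b.
Proof.
move=> alB; apply: (le_trans (ler_norm_sum _ _ _)).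
under eq_bigr do rewrite normrM.
have [e|p11] : p = 1 \/ 1 < p by move: p1; rewrite le_eqVlt => /orP[/eqP|]; auto.
  move: alB; rewrite e hoelder_conjugate1 => alB.
  have -> : lp_norm m b = \sum_(i < m) `|b i|.
    rewrite /lp_norm e invr1 powRr1; last by apply: sumr_ge0 => i _; exact: powR_ge0.
    by apply: eq_bigr => i _; rewrite powRr1.
  by apply: ler_sum => i _; rewrite ler_piMl.
move: alB; rewrite hoelder_conjugate_fin// => alB.
set q := p / (p - 1) in alB.
have p10 : 0 < p - 1 by rewrite subr_gt0.
have q0 : 0 < q by rewrite divr_gt0.
have pq : p^-1 + q^-1 = 1 by rewrite /q invf_div; field; rewrite pn0.
set r := lp_norm m b.
have := lp_norm_ge0 m b; rewrite le_eqVlt => /orP[/eqP r0|r0].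
  rewrite -/r in r0; rewrite -r0 big1// => i _.
  have := le_lp_norm b (ltn_ord i); rewrite -/r -r0 normr_le0 => /eqP ->.
  by rewrite normr0 mulr0.
rewrite -/r in r0; rewrite -[leRHS]mul1r -ler_pdivrMr// mulr_suml.
apply: (@le_trans _ _ (\sum_(i < m) (`|al i| `^ q / q + (`|b i| / r) `^ p / p))).
  apply: ler_sum => i _; rewrite -mulrA; apply: conjugate_powR => //.
    by rewrite divr_ge0// ltW.
  by rewrite addrC.
rewrite big_split /= -!mulr_suml -pq addrC; apply: lerD.
  rewrite -[leRHS]mul1r ler_wpM2r// ?invr_ge0 ?(ltW p0)//.
  under eq_bigr do rewrite powRM ?invr_ge0 ?(ltW r0)//.
  rewrite -mulr_suml -lp_normX -/r -powRM ?invr_ge0 ?(ltW r0)//.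
  by rewrite mulfV ?gt_eqF// powR1.
by rewrite -[leRHS]mul1r ler_wpM2r// invr_ge0 ltW.
Qed.

(** Equality in Hoelder's inequality is attained at the sequence sgn(b_i)
|b_i|^(p - 1), normalized; for p = 1 it is just sgn(b_i). *)
Lemma lq_ball_norming m (b : nat -> R) : exists al : 'I_m -> R,
  lq_ball (hoelder_conjugate p%:E) al /\ \sum_(i < m) al i * b i = lp_norm m b.
Proof.
have [e|p11] : p = 1 \/ 1 < p by move: p1; rewrite le_eqVlt => /orP[/eqP|]; auto.
  exists (fun i => Num.sg (b i)); rewrite e hoelder_conjugate1; split.
    by move=> i /=; rewrite normr_sg; case: (b i != 0).
  rewrite /lp_norm e invr1 powRr1; last by apply: sumr_ge0 => i _; exact: powR_ge0.
  by apply: eq_bigr => i _; rewrite powRr1// -normrEsg.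
rewrite hoelder_conjugate_fin//; set q := p / (p - 1).
have p10 : 0 < p - 1 by rewrite subr_gt0.
set r := lp_norm m b.
have := lp_norm_ge0 m b; rewrite le_eqVlt => /orP[/eqP r0|r0].
  exists (fun=> 0); split.
    rewrite /= big1// => i _; rewrite normr0 powR0// /q mulf_neq0//.
    by rewrite invr_eq0 gt_eqF.
  by rewrite /r -r0 big1// => i _; rewrite mul0r.
rewrite -/r in r0.
exists (fun i => Num.sg (b i) * (`|b i| / r) `^ (p - 1)); split.
  have S1 : \sum_(i < m) (`|b i| / r) `^ p = 1.
    under eq_bigr do rewrite powRM ?invr_ge0 ?(ltW r0)//.
    rewrite -mulr_suml -lp_normX -/r -powRM ?invr_ge0 ?(ltW r0)//.
    by rewrite mulfV ?gt_eqF// powR1.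
  rewrite /lq_ball -[leRHS]S1.
  apply: ler_sum => i _; rewrite normrM norm_powR ?divr_ge0 ?(ltW r0)//.
  rewrite [X in _ * X `^ _]ger0_norm ?divr_ge0 ?(ltW r0)//.
  rewrite normr_sg; have [->|b0] := eqVneq (b i) 0.
    by rewrite /= mul0r powR0 ?powR_ge0// mulf_neq0// invr_eq0 gt_eqF.
  by rewrite /= mul1r -powRrM /q mulrCA mulfV ?mulr1// gt_eqF.
have -> : \sum_(i < m) Num.sg (b i) * (`|b i| / r) `^ (p - 1) * b i =
    \sum_(i < m) r * (`|b i| / r) `^ p.
  apply: eq_bigr => i _; rewrite -[in RHS]mulr_powRB1 ?divr_ge0 ?(ltW r0)//.
  move: (_ `^ (p - 1)) => t; rewrite mulrAC -normrEsg.
  by rewrite mulrA mulrCA mulfV ?mulr1// gt_eqF.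
rewrite -mulr_sumr.
under eq_bigr do rewrite powRM ?invr_ge0 ?(ltW r0)//.
rewrite -mulr_suml -lp_normX -/r -powRM ?invr_ge0 ?(ltW r0)//.
by rewrite mulfV ?gt_eqF// powR1 mulr1.
Qed.

End FiniteLp.

Section FiniteLpSequences.
Context {R : realType} (p : R) (p1 : 1 <= p).

(** Extending a norming functional of the first L terms by zero keeps its norm
on sequences of any length. *)
Lemma norming_sequence (L : nat) (be : nat -> R) : exists g : nat -> R,
  (forall m (b : nat -> R), `|\sum_(i < m) g i * b i| <= lp_norm p m b) /\
  \sum_(i < L) g i * be i = lp_norm p L be.
Proof.
have [al [alB alE]] := lq_ball_norming p1 L be.
pose g i := if insub i is Some j then al j else 0.
have gE (j : 'I_L) : g j = al j by rewrite /g valK.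
have g0 i : (L <= i)%N -> g i = 0.
  by rewrite /g; case: insubP => // j _ <-; rewrite leqNgt ltn_ord.
exists g; split; last by rewrite -alE; apply: eq_bigr => j _; rewrite gE.
move=> m b; pose M := maxn L m; pose b' i := if (i < m)%N then b i else 0.
have -> : lp_norm p m b = lp_norm p M b'.
  have -> : lp_norm p M b' = lp_norm p m b'.
    by apply: lp_norm_widen; rewrite ?leq_maxr// => i mi; rewrite /b' ltnNge mi.
  by apply: eq_lp_norm => // i im; rewrite /b' im.
have -> : \sum_(i < m) g i * b i = \sum_(i < L) al i * b' i.
  transitivity (\sum_(i < M) g i * b' i).
    rewrite (big_ord_widen _ (fun i => g i * b i) (leq_maxr L m)) big_mkcond /=.
    by apply: eq_bigr => i _; rewrite /b'; case: ifP; rewrite ?mulr0.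
  under [RHS]eq_bigr do rewrite -gE.
  rewrite (big_ord_widen _ (fun i => g i * b' i) (leq_maxl L m)) [RHS]big_mkcond /=.
  by apply: eq_bigr => i _; case: ltnP => // /g0 ->; rewrite mul0r.
apply: (le_trans (lq_ball_hoelder p1 b' alB)).
have -> : lp_norm p L b' = lp_norm p M (fun i => if (i < L)%N then b' i else 0).
  apply/esym; have -> : lp_norm p L b' = lp_norm p L (fun i => if (i < L)%N then b' i else 0).
    by apply: eq_lp_norm => // i ->.
  by apply: lp_norm_widen; rewrite ?leq_maxl// => i Li; rewrite ltnNge Li.
by apply: ler_lp_norm => // i _; case: ifP => // _; rewrite normr0.
Qed.

(** At most one of the x k is nonzero, so the sum has at most one term. *)
Lemma power_sum_disjoint (x : nat -> R) m :
  (forall j k, x j != 0 -> x k != 0 -> j = k) ->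
  `|\sum_(k < m) x k| `^ p <= \sum_(k < m) `|x k| `^ p.
Proof.
move=> xu; have p0 : 0 < p := lt_le_trans ltr01 p1.
have [[k xk]|no] := pselect (exists k : 'I_m, x k != 0).
  rewrite (bigD1 k)//= big1 ?addr0 => [|j jk]; last first.
    apply/eqP; apply: contraNT jk => xj; apply/eqP/val_inj.
    exact: xu.
  by rewrite (bigD1 k)//= lerDl; apply: sumr_ge0 => j _; exact: powR_ge0.
rewrite big1 ?normr0 ?powR0 ?gt_eqF//; last first.
  by move=> k _; apply/eqP/negPn/negP => xk; apply: no; exists k.
by apply: sumr_ge0 => j _; exact: powR_ge0.
Qed.

Definition power_mass (m : nat) (b : nat -> nat -> R) : R :=
  \sum_(n < m) \sum_(i < m) `|b n i| `^ p.

Lemma power_mass_ge0 m b : 0 <= power_mass m b.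
Proof. by apply: sumr_ge0 => n _; apply: sumr_ge0 => i _; exact: powR_ge0. Qed.

Lemma power_mass_rows m b :
  power_mass m b = \sum_(n < m) lp_norm p m (b n) `^ p.
Proof. by apply: eq_bigr => n _; rewrite lp_normX. Qed.

End FiniteLpSequences.

(** * The lattice structure of X on finite combinations of the basis *)

Definition fincomb (R : realType) (V : lmodType R) (e : nat -> V) (m : nat)
    (a : nat -> R) : V := \sum_(n < m) a n *: e n.

Section Basis.
Context {R : realType} {X : completeNormedModType R} (e : nat -> X)
  (he : schauder_basis e).

Local Notation fin := (fincomb e).

Lemma expansion_series x a : expansion e x a <-> (fun m => fin m a) @ \oo --> x.
Proof.
rewrite /expansion; suff -> : series (fun n => a n *: e n) = (fun m => fin m a) by [].
by apply/funext => m; rewrite /series /= big_mkord.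
Qed.

Lemma coordP x : expansion e x (Defs.coord e x).
Proof. by have [a [ax _]] := he x; apply: (xgetI _ ax). Qed.
Arguments coordP x : clear implicits.

Lemma coord_unique x a : expansion e x a -> Defs.coord e x = a.
Proof.
move=> xa; have [c [_ cu]] := he x.
by rewrite -(cu _ (coordP x)) (cu _ xa).
Qed.

Lemma coord_inj x y : (forall n, Defs.coord e x n = Defs.coord e y n) -> x = y.
Proof.
move=> /funext xy; have := coordP y; rewrite -xy => yx.
exact: (norm_cvg_unique (coordP x) yx).
Qed.

Lemma fincomb_expansion m a :
  expansion e (fin m a) (fun n => if (n < m)%N then a n else 0).
Proof.
apply/expansion_series; apply: cvg_near_cst; exists m => // k /= mk.
rewrite /fincomb (big_ord_widen _ (fun n => a n *: e n) mk) [RHS]big_mkcond /=.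
by apply: eq_bigr => i _; case: ifP => // _; rewrite scale0r.
Qed.
Arguments fincomb_expansion m a : clear implicits.

Lemma coord_fincomb m a n : Defs.coord e (fin m a) n = if (n < m)%N then a n else 0.
Proof. by rewrite (coord_unique (fincomb_expansion m a)). Qed.

Lemma coordZD t x y n : Defs.coord e (t *: x + y) n = t * Defs.coord e x n + Defs.coord e y n.
Proof.
have : expansion e (t *: x + y) (fun n => t * Defs.coord e x n + Defs.coord e y n).
  apply/expansion_series.
  have -> : (fun m => fin m (fun n => t * Defs.coord e x n + Defs.coord e y n)) =
      (fun m => t *: fin m (Defs.coord e x) + fin m (Defs.coord e y)).
    apply/funext => m; rewrite /fincomb scaler_sumr -big_split /=.
    by apply: eq_bigr => i _; rewrite scalerDl scalerA.
  by apply: cvgD; [apply: cvgZr|]; apply/expansion_series; exact: coordP.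
by move=> /coord_unique ->.
Qed.

Lemma coord_zero n : Defs.coord e 0 n = 0.
Proof. by have := coord_fincomb 0 (fun=> 0) n; rewrite /fincomb big_ord0. Qed.

Lemma coordZ t x n : Defs.coord e (t *: x) n = t * Defs.coord e x n.
Proof. by rewrite -[t *: x]addr0 coordZD coord_zero addr0. Qed.

Lemma coordN x n : Defs.coord e (- x) n = - Defs.coord e x n.
Proof. by rewrite -scaleN1r coordZ mulN1r. Qed.

Lemma coord_basis m n : Defs.coord e (e m) n = (n == m)%:R.
Proof.
have -> : e m = fin m.+1 (fun n => (n == m)%:R).
  rewrite /fincomb big_ord_recr /= eqxx scale1r big1 ?add0r// => i _.
  by rewrite ltn_eqF// scale0r.
rewrite coord_fincomb ltnS; case: leqP => // mn.
by rewrite gtn_eqF.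
Qed.

Lemma basis_neq0 m : e m != 0.
Proof.
apply/eqP => e0; have := coord_basis m m; rewrite e0 coord_zero eqxx => /eqP.
by rewrite eq_sym oner_eq0.
Qed.

Lemma fincomb_dense : dense [set x | exists m a, x = fin m a].
Proof.
apply: approx_dense => x d d0.
have /expansion_series/cvgrPdist_lt/(_ d d0) [m _ mP] := coordP x.
by exists (fin m (Defs.coord e x)); [exists m, (Defs.coord e x)|apply: mP => /=].
Qed.

Lemma basis_le_anti x y : basis_le e x y -> basis_le e y x -> x = y.
Proof. by move=> xy yx; apply: coord_inj => n; apply/eqP; rewrite eq_le xy yx. Qed.

Lemma lattice_sup_unique (A : set X) s : is_lattice_sup e A s -> lattice_sup e A = s.
Proof.
move=> sA; apply: xget_unique => // t tA; apply: basis_le_anti.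
  by apply: tA.2; exact: sA.1.
by apply: sA.2; exact: tA.1.
Qed.

Lemma lattice_abs_exists x y : (forall n, Defs.coord e y n = `|Defs.coord e x n|) ->
  lattice_abs e x = y.
Proof.
move=> yx; apply: lattice_sup_unique; split=> [_ [->|->] n|t tx n].
- by rewrite yx ler_norm.
- by rewrite yx coordN -normrN ler_norm.
- rewrite yx ler_norml lerNl -coordN; apply/andP; split.
    by apply: (tx (- x)); right.
  by apply: (tx x); left.
Qed.

(** Suprema for the coordinatewise order are coordinatewise, since the upper
bounds can be changed one coordinate at a time. *)
Lemma coord_is_abs x y : is_lattice_sup e [set x; - x] y ->
  forall n, Defs.coord e y n = `|Defs.coord e x n|.
Proof.
move=> [yu yl] n; have lower k : `|Defs.coord e x k| <= Defs.coord e y k.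
  rewrite ler_norml lerNl -coordN; apply/andP; split.
    by apply: (yu (- x)); right.
  by apply: (yu x); left.
apply/eqP; rewrite eq_le lower andbT.
(* replacing the n-th coordinate of y by |x_n| leaves an upper bound *)
pose t := (`|Defs.coord e x n| - Defs.coord e y n) *: e n + y.
have tE k : Defs.coord e t k = if k == n then `|Defs.coord e x n| else Defs.coord e y k.
  rewrite coordZD coord_basis; case: eqP => [->|_]; first by rewrite mulr1 subrK.
  by rewrite mulr0 add0r.
have : basis_le e y t.
  apply: yl => _ [->|->] k; rewrite tE; case: eqP => [->|_].
  - exact: ler_norm.
  - exact: le_trans (ler_norm _) (lower k).
  - by rewrite coordN -normrN ler_norm.
  - by rewrite coordN (le_trans _ (lower k))// -normrN ler_norm.
by move=> /(_ n); rewrite tE eqxx.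
Qed.

Lemma lattice_abs_junk x : ~ (exists y, forall n, Defs.coord e y n = `|Defs.coord e x n|) ->
  lattice_abs e x = 0.
Proof.
move=> no; apply: xgetPN => y /coord_is_abs yx.
by apply: no; exists y.
Qed.

Lemma lattice_abs_fincomb m a : lattice_abs e (fin m a) = fin m (fun n => `|a n|).
Proof.
apply: lattice_abs_exists => n; rewrite !coord_fincomb.
by case: ifP => // _; rewrite normr0.
Qed.

Section Norm.
Context (N : X -> R) (hlat : lattice_norm e N) (hN : equivalent_norm N).

Lemma lattice_norm_fincomb m a b : (forall n, (n < m)%N -> `|a n| <= `|b n|) ->
  N (fin m a) <= N (fin m b).
Proof.
move=> ab; apply: hlat => n; rewrite !lattice_abs_fincomb !coord_fincomb.
by case: ifP => // /ab.
Qed.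

Lemma equivalent_norm0 : N 0 = 0.
Proof. by have [_ /(_ 0 0) + _] := hN; rewrite scale0r normr0 mul0r. Qed.

Lemma equivalent_norm_sum k (v : nat -> X) :
  N (\sum_(n < k) v n) <= \sum_(n < k) N (v n).
Proof.
have [ND _ _] := hN; elim: k => [|k IH].
  by rewrite !big_ord0 equivalent_norm0.
by rewrite !big_ord_recr /= (le_trans (ND _ _))// lerD2r.
Qed.

Lemma equivalent_norm_gt0 x : x != 0 -> 0 < N x.
Proof.
move=> x0; have [_ _ [c [C [c0 _ /(_ x)[+ _]]]]] := hN.
by apply: lt_le_trans; rewrite mulr_gt0// normr_gt0.
Qed.

Context (p : R) (p1 : 1 <= p).

Lemma fincomb_sum k m (al : 'I_k -> R) (b : nat -> nat -> R) :
  \sum_(i < k) al i *: fin m (fun n => b n i) =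
  fin m (fun n => \sum_(i < k) al i * b n i).
Proof.
rewrite /fincomb; under eq_bigr do rewrite scaler_sumr.
rewrite exchange_big /=; apply: eq_bigr => n _; rewrite scaler_suml.
by apply: eq_bigr => i _; rewrite scalerA.
Qed.

(** The lattice expression (sum |x_i|^p)^(1/p) is computed coordinatewise: by
duality its n-th coordinate is the supremum of |sum_i al_i b n i| over the
unit ball of l_p', which is attained. *)
Lemma lattice_lp_fincomb k m (b : nat -> nat -> R) :
  lattice_lp e p (fun i : 'I_k => fin m (fun n => b n i)) =
  fin m (fun n => lp_norm p k (b n)).
Proof.
apply: lattice_sup_unique; split=> [_ [al /= alB <-] n|t tb n].
  rewrite fincomb_sum lattice_abs_fincomb !coord_fincomb; case: ifP => // _.
  exact: lq_ball_hoelder.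
have [al [alB ale]] := lq_ball_norming p1 k (b n).
have /(_ n) := tb (lattice_abs e (\sum_(i < k) al i *: fin m (fun n => b n i)))
  (ex_intro2 _ _ al alB erefl).
rewrite fincomb_sum lattice_abs_fincomb !coord_fincomb; case: ifP => // _.
by rewrite ale normr_lp_norm.
Qed.

(** This bound makes the placement of a vector of X at a given position of a
sequence continuous, which reduces the density of finite arrays to that of
finite combinations of the basis. *)
Lemma lattice_lp_single k (j : 'I_k) (x : X) :
  N (lattice_lp e p (fun i : 'I_k => if i == j then x else 0)) <= N x.
Proof.
have sumE (al : 'I_k -> R) :
    \sum_(i < k) al i *: (if i == j then x else 0) = al j *: x.
  rewrite (bigD1 j)//= eqxx big1 ?addr0// => i /negbTE ->.
  by rewrite scaler0.
have al1 (al : 'I_k -> R) : lq_ball (hoelder_conjugate p%:E) al -> `|al j| <= 1.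
  move=> /(lq_ball_hoelder p1 (fun i => (i == j :> nat)%:R)).
  rewrite (bigD1 j)//= eqxx mulr1 big1 ?addr0 => [|i]; last first.
    by rewrite -val_eqE => /negbTE ->; rewrite mulr0.
  move=> h; apply: (le_trans h).
  rewrite (lp_norm_unique p1 (r := 1))// powR1 (bigD1 j)//= eqxx normr1 powR1.
  rewrite big1 ?addr0// => i; rewrite -val_eqE => /negbTE ->.
  by rewrite normr0 powR0// gt_eqF// (lt_le_trans ltr01).
rewrite /lattice_lp; set A := (X in lattice_sup e X).
have [al0 [al0B _]] := lq_ball_norming p1 k (fun=> 0).
have Nx0 : 0 <= N x.
  by have [->|/equivalent_norm_gt0/ltW//] := eqVneq x 0; rewrite equivalent_norm0.
(* if x has no modulus in X, then A = {0}: the moduli in A are defaults *)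
have [[z zx]|noabs] := pselect (exists z, forall n, Defs.coord e z n = `|Defs.coord e x n|).
  rewrite /lattice_sup; case: xgetP => [s sE [su sl]|_]; last by rewrite equivalent_norm0.
  have absE t : lattice_abs e (t *: x) = `|t| *: z.
    by apply: lattice_abs_exists => n; rewrite !coordZ zx normrM.
  have sz : basis_le e s z.
    apply: sl => _ [al alB <-] n; rewrite sumE absE coordZ zx ler_piMl//.
    exact: al1.
  have s0 n : 0 <= Defs.coord e s n.
    apply: le_trans (su _ (ex_intro2 _ _ al0 al0B erefl) n).
    by rewrite sumE absE coordZ zx mulr_ge0.
  apply: hlat => n.
  rewrite (lattice_abs_exists zx) (@lattice_abs_exists s s) => [|i]; first exact: sz.
  by rewrite ger0_norm.
have A0 : A = [set 0].
  have abs0 t : lattice_abs e (t *: x) = 0.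
    have [->|t0] := eqVneq t 0.
      rewrite scale0r; apply: lattice_abs_exists => n.
      by rewrite coord_zero normr0.
    apply: lattice_abs_junk => -[z zx]; apply: noabs; exists (`|t|^-1 *: z) => n.
    by rewrite coordZ zx coordZ normrM mulrA mulVf ?mul1r// normr_eq0.
  apply/seteqP; split=> [_ [al _ <-]|_ ->]; first by rewrite sumE abs0.
  by exists al0 => //; rewrite sumE abs0.
rewrite A0 (@lattice_sup_unique _ 0) ?equivalent_norm0//.
by split=> [_ -> //|t]; apply.
Qed.

End Norm.

End Basis.

(** * The completion W as a space of arrays *)

Definition array (R : realType) (V : lmodType R) (E : nat -> nat -> V) (m : nat)
    (b : nat -> nat -> R) : V := \sum_(n < m) \sum_(i < m) b n i *: E n i.

Lemma single_subproof (R : realType) (X : lmodType R) (i : nat) (x : X) :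
  (fun k => if k == i then x else 0) \in @finitely_supported R X.
Proof.
by apply/asboolP; exists i.+1 => k ik; rewrite gtn_eqF.
Qed.

Definition single (R : realType) (X : lmodType R) (i : nat) (x : X) : finseq X :=
  FinSeq (single_subproof i x).

Section Single.
Context {R : realType} {X : lmodType R}.

Lemma finseq_ext (u v : finseq X) : (forall k, u k = v k) -> u = v.
Proof. by move=> uv; apply: val_inj; apply/funext. Qed.

Lemma finseq_sumE I (r : seq I) (F : I -> finseq X) k :
  (\sum_(i <- r) F i) k = \sum_(i <- r) F i k.
Proof.
elim: r => [|i r IH]; first by rewrite !big_nil.
by rewrite !big_cons -IH.
Qed.

Lemma singleZD i t (x y : X) : single i (t *: x + y) = t *: single i x + single i y.
Proof.
apply: finseq_ext => k.
rewrite [RHS](_ : _ = t *: single i x k + single i y k)//=.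
by case: eqP => // _; rewrite scaler0 addr0.
Qed.

Lemma finseq_vanish (v : finseq X) : vanishes_from v (finseq_length v).
Proof.
rewrite /finseq_length; have /asboolP[m vm] := finseq_valP v.
exact: (xgetI _ vm).
Qed.

Lemma finseq_decomposition (v : finseq X) m : vanishes_from v m ->
  v = \sum_(i < m) single i (v i).
Proof.
move=> vm; apply: finseq_ext => k; rewrite finseq_sumE /=.
have [km|mk] := ltnP k m; last first.
  by rewrite vm// big1// => i _; rewrite gtn_eqF// (leq_trans (ltn_ord i)).
rewrite (bigD1 (Ordinal km))//= eqxx big1 ?addr0// => i.
by rewrite -val_eqE /= eq_sym => /negbTE ->.
Qed.

End Single.

Section UnitVectors.
Context {R : realType} {X : completeNormedModType R} (e : nat -> X)
  (he : schauder_basis e) (N : X -> R) (hN : equivalent_norm N)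
  (hlat : lattice_norm e N) (p : R) (p1 : 1 <= p)
  (W : completeNormedModType R) (J : {linear finseq X -> W})
  (JN : forall v, `|J v| = Xlp_norm e N p v) (Jd : dense (range J)).

Let E n i := J (single i (e n)).

Lemma place_operator i : exists2 S : {linear X -> W},
  (exists2 C : R, 0 < C & forall x, `|S x| <= C * `|x|) &
  forall x, S x = J (single i x).
Proof.
have [S SE] : exists S : {linear X -> W}, forall x, S x = J (single i x).
  by apply: linear_of_function => a u v; rewrite singleZD linearP.
exists S => //; have [_ _ [c [C [c0 C0 NC]]]] := hN; exists C => // u.
rewrite SE JN /Xlp_norm; apply: le_trans (NC u).2.
have v0 := @finseq_vanish _ _ (single i u).
set L := finseq_length _ in v0 *.
have [iL|Li] := ltnP i L.
  exact: (lattice_lp_single he hlat hN p1 (Ordinal iL) u).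
have u0 : u = 0 by have := v0 i Li; rewrite /= eqxx.
have -> : (fun k : 'I_L => single i u k) = (fun k : 'I_L => fincomb e 0 (fun n => 0)).
  by apply/funext => k /=; rewrite /fincomb big_ord0 u0 if_same.
rewrite (lattice_lp_fincomb he p1 L 0 (fun _ _ => 0)) /fincomb big_ord0 u0.
by [].
Qed.

Lemma array_image m b : array E m b =
  \sum_(i < m) J (single i (fincomb e m (fun n => b n i))).
Proof.
rewrite /array exchange_big /=; apply: eq_bigr => i _.
have [S _ SE] := place_operator i.
by rewrite -SE linear_sum; apply: eq_bigr => n _; rewrite linearZ /= SE.
Qed.

(** The norm does not see the length chosen for the sequence: past its support
the entries are zero, and so are those past m. *)
Lemma norm_array m b :
  `|array E m b| = N (fincomb e m (fun n => lp_norm p m (b n))).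
Proof.
rewrite array_image -linear_sum JN /Xlp_norm; set v := \sum_(i < m) _.
(* b' gives the entries of v in all columns, also beyond m *)
pose b' n i := if (i < m)%N then b n i else 0.
have vE k : v k = fincomb e m (fun n => b' n k).
  rewrite /v finseq_sumE /b'; have [km|mk] := ltnP k m.
    rewrite (bigD1 (Ordinal km))//= eqxx big1 ?addr0// => i.
    by rewrite -val_eqE /= eq_sym => /negbTE ->.
  rewrite big1 => [|i _ /=]; last by rewrite gtn_eqF// (leq_trans (ltn_ord i)).
  by rewrite /fincomb big1// => n _; rewrite scale0r.
have vL := @finseq_vanish _ _ v; set L := finseq_length v in vL *.
have b0 n i : (n < m)%N -> (L <= i)%N -> b' n i = 0.
  move=> nm Li; have := vL i Li; rewrite vE => v0.
  by have := coord_fincomb he m (fun n => b' n i) n; rewrite v0 coord_zero// nm.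
have -> : (fun i : 'I_L => v i) = (fun i : 'I_L => fincomb e m (fun n => b' n i)).
  by apply/funext => i; rewrite vE.
rewrite lattice_lp_fincomb//; congr N; rewrite /fincomb; apply: eq_bigr => n _.
congr (_ *: _).
have -> : lp_norm p L (b' n) = lp_norm p (maxn L m) (b' n).
  by apply/esym; apply: lp_norm_widen; rewrite ?leq_maxl// => i; exact: b0.
have -> : lp_norm p (maxn L m) (b' n) = lp_norm p m (b' n).
  by apply: lp_norm_widen; rewrite ?leq_maxr// => i mi; rewrite /b' ltnNge mi.
by apply: eq_lp_norm => // i im; rewrite /b' im.
Qed.

(** A sequence of length L is within d / 2 of w, and each of its L entries is
approximated by a partial sum of its expansion, all with a common length. *)
Lemma array_dense : dense [set x | exists m b, x = array E m b].
Proof.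
apply: approx_dense => w d d0.
have d2 : 0 < d / 2 by rewrite divr_gt0.
have [_ [v _ <-] wv] := dense_approx Jd w d2.
have vL := @finseq_vanish _ _ v; set L := finseq_length v in vL.
have /choice[S SP] : forall i, exists S : {linear X -> W},
    (exists2 C : R, 0 < C & forall x, `|S x| <= C * `|x|) /\
    forall x, S x = J (single i x).
  by move=> i; have [S SC SE] := place_operator i; exists S.
have close : \forall m \near \oo, forall i : 'I_L,
    `|S i (v i) - S i (fincomb e m (Defs.coord e (v i)))| < d / 2 / L.+1%:R.
  apply: filter_forall => i.
  have [[C C0 SC] _] := SP i.
  have e0 : 0 < d / 2 / L.+1%:R / C by rewrite !divr_gt0.
  have /expansion_series/cvgrPdist_lt/(_ _ e0) := @coordP _ _ e he (v i).
  apply: filterS => m; rewrite ltr_pdivlMr// mulrC => h.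
  by rewrite -linearB; apply: le_lt_trans h.
have [m [Lm mP]] : exists m, (L <= m)%N /\ forall i : 'I_L,
    `|S i (v i) - S i (fincomb e m (Defs.coord e (v i)))| < d / 2 / L.+1%:R.
  have [M _ MP] := close; exists (maxn L M); split; first exact: leq_maxl.
  by apply: (MP (maxn L M)) => /=; exact: leq_maxr.
pose b n i := if (i < L)%N then Defs.coord e (v i) n else 0.
exists (array E m b); first by exists m, b.
have -> : array E m b = \sum_(i < L) S i (fincomb e m (Defs.coord e (v i))).
  rewrite array_image (big_ord_widen _ (fun i => S i (fincomb e m (Defs.coord e (v i)))) Lm).
  rewrite [RHS]big_mkcond /=; apply: eq_bigr => i _.
  have [_ <-] := SP i; case: ifP => iL.
    by congr (S i _); apply: eq_bigr => n _; rewrite /b iL.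
  rewrite -[RHS](linear0 (S i)); congr (S i _); rewrite /fincomb big1// => n _.
  by rewrite /b iL scale0r.
have JvE : J v = \sum_(i < L) S i (v i).
  rewrite {1}(finseq_decomposition vL) linear_sum; apply: eq_bigr => i _.
  by have [_ <-] := SP i.
have -> : w - \sum_(i < L) S i (fincomb e m (Defs.coord e (v i))) =
    (w - J v) + \sum_(i < L) (S i (v i) - S i (fincomb e m (Defs.coord e (v i)))).
  by rewrite sumrB -JvE addrA subrK.
apply: (le_lt_trans (ler_normD _ _)); rewrite [ltRHS](splitr d).
apply: ltr_leD => //; apply: (le_trans (ler_norm_sum _ _ _)).
apply: (@le_trans _ _ (\sum_(i < L) d / 2 / L.+1%:R)).
  by apply: ler_sum => i _; exact: ltW.
rewrite sumr_const card_ord -[leLHS]mulr_natr; move: (d / 2) d2 => t t0.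
by rewrite mulrAC ler_pdivrMr// ler_wpM2l ?(ltW t0)// ler_nat.
Qed.

End UnitVectors.

(** * Operators defined on the unit vectors of W *)

Definition cutoff (R : realType) (D : nat -> nat -> bool) (b : nat -> nat -> R)
    (n i : nat) : R := if D n i then b n i else 0.

Definition supported (R : realType) (D : nat -> nat -> bool) (b : nat -> nat -> R) :=
  forall n i, ~~ D n i -> b n i = 0.

Definition box (m n i : nat) : bool := (n < m)%N && (i < m)%N.

Definition unit_array (R : realType) (n i : nat) : nat -> nat -> R :=
  fun n' i' => ((n' == n) && (i' == i))%:R.

Section Arrays.
Context {R : realType} {V : lmodType R}.
Implicit Types (F : nat -> nat -> V) (b c : nat -> nat -> R).

Lemma arrayZD F m t b c :
  array F m (fun n i => t * b n i + c n i) = t *: array F m b + array F m c.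
Proof.
rewrite /array scaler_sumr -big_split /=; apply: eq_bigr => n _.
rewrite scaler_sumr -big_split /=; apply: eq_bigr => i _.
by rewrite scalerDl scalerA.
Qed.

Lemma arrayZ F m t b : array F m (fun n i => t * b n i) = t *: array F m b.
Proof.
rewrite /array scaler_sumr; apply: eq_bigr => n _.
by rewrite scaler_sumr; apply: eq_bigr => i _; rewrite scalerA.
Qed.

Lemma eq_array F m b c : (forall n i, box m n i -> b n i = c n i) ->
  array F m b = array F m c.
Proof.
move=> bc; apply: eq_bigr => n _; apply: eq_bigr => i _.
by rewrite bc// /box !ltn_ord.
Qed.

Lemma array_sum F m r (a : nat -> R) (b : nat -> nat -> nat -> R) :
  array F m (fun n i => \sum_(k < r) a k * b k n i) =
  \sum_(k < r) a k *: array F m (b k).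
Proof.
elim: r => [|r IH].
  rewrite big_ord0 /array big1// => n _; rewrite big1// => i _.
  by rewrite big_ord0 scale0r.
rewrite big_ord_recr /= -IH addrC -arrayZD; apply: eq_array => n i _.
by rewrite big_ord_recr /= addrC.
Qed.

Lemma array_widen F m m' b : (m <= m')%N -> supported (box m) b ->
  array F m' b = array F m b.
Proof.
move=> mm' b0; rewrite /array.
rewrite (big_ord_widen _ (fun n => \sum_(i < m) b n i *: F n i) mm').
rewrite [RHS]big_mkcond /=; apply: eq_bigr => n _.
rewrite (big_ord_widen _ (fun i => b n i *: F n i) mm') [in RHS]big_mkcond /=.
have [nm|mn] := ltnP n m.
  apply: eq_bigr => i _; case: ifPn => // im.
  by rewrite b0 ?scale0r// /box nm.
by apply: big1 => i _; rewrite b0 ?scale0r// /box ltnNge mn.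
Qed.

Lemma array_cutoff_box F m b : array F m (cutoff (box m) b) = array F m b.
Proof. by apply: eq_array => n i bni; rewrite /cutoff bni. Qed.

Lemma array_cutoff F D m b :
  array F m (cutoff D b) = array (fun n i => if D n i then F n i else 0) m b.
Proof.
apply: eq_bigr => n _; apply: eq_bigr => i _; rewrite /cutoff.
by case: ifP => _; rewrite ?scaler0 ?scale0r.
Qed.

Lemma array_unit F m n i : (n < m)%N -> (i < m)%N ->
  array F m (unit_array R n i) = F n i.
Proof.
move=> nm im; rewrite /array (bigD1 (Ordinal nm))//= (bigD1 (Ordinal im))//=.
rewrite /unit_array !eqxx scale1r big1 ?addr0 => [|j]; last first.
  by rewrite -val_eqE => /negbTE /= ->; rewrite scale0r.
rewrite big1 ?addr0// => k; rewrite -val_eqE => /negbTE /= ->.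
by apply: big1 => j _; rewrite scale0r.
Qed.

Lemma array0 F m b :
  (forall n i, b n i = 0) -> array F m b = 0.
Proof. by move=> b0; rewrite /array big1// => n _; rewrite big1// => i _; rewrite b0 scale0r. Qed.

End Arrays.

Lemma linear_array (R : realType) (V U : lmodType R) (A : {linear V -> U})
    (F : nat -> nat -> V) m (b : nat -> nat -> R) :
  A (array F m b) = array (fun n i => A (F n i)) m b.
Proof.
rewrite linear_sum; apply: eq_bigr => n _; rewrite linear_sum.
by apply: eq_bigr => i _; rewrite linearZ.
Qed.

Lemma supported_cutoff (R : realType) D (b : nat -> nat -> R) : supported D (cutoff D b).
Proof. by move=> n i /negbTE; rewrite /cutoff => ->. Qed.

Lemma cutoff_id (R : realType) D (b : nat -> nat -> R) : supported D b -> cutoff D b = b.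
Proof.
move=> Db; apply/funext => n; apply/funext => i; rewrite /cutoff.
by case: ifPn => // /Db.
Qed.

(** Each position (n, i) has a level, its row in one application and its
column in the other; the k-th block has the positions with level in [t k, t (k
+ 1)) that lie in the region S. *)
Definition block (lev : nat -> nat -> nat) (S : nat -> nat -> bool) (t : nat -> nat)
    (k n i : nat) : bool :=
  [&& S n i, (t k <= lev n i)%N & (lev n i < t k.+1)%N].

Lemma increasing_leq (t : nat -> nat) : (forall k, (t k < t k.+1)%N) ->
  forall j k, (j <= k)%N -> (t j <= t k)%N.
Proof.
move=> tS j k /subnK <-; elim: (k - j)%N => [//|r IH].
by rewrite addSn (leq_trans IH)// ltnW.
Qed.

Lemma increasing_ge (t : nat -> nat) : (forall k, (t k < t k.+1)%N) ->
  forall k, (k <= t k)%N.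
Proof. by move=> tS; elim=> // k IH; exact: leq_ltn_trans (tS k). Qed.

Lemma block_disjoint lev S t : (forall k, (t k < t k.+1)%N) ->
  forall j k n i, block lev S t j n i -> block lev S t k n i -> j = k.
Proof.
move=> tS j k n i /and3P[_ h1 h2] /and3P[_ h3 h4].
have tm := increasing_leq tS.
apply/eqP; rewrite eqn_leq; apply/andP; split; rewrite leqNgt; apply/negP => h.
  by have := leq_trans h4 (leq_trans (tm _ _ h) h1); rewrite ltnn.
by have := leq_trans h2 (leq_trans (tm _ _ h) h3); rewrite ltnn.
Qed.

Lemma ler_sum_first (R : realType) (m n0 : nat) (F : nat -> R) : (forall n, 0 <= F n) ->
  (forall n, (n0 <= n)%N -> F n = 0) -> \sum_(n < m) F n <= \sum_(n < n0) F n.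
Proof.
move=> F0 Fz; rewrite (big_ord_widen _ F (leq_maxl m n0)).
rewrite (big_ord_widen _ F (leq_maxr m n0)) big_mkcond [leRHS]big_mkcond /=.
apply: ler_sum => n _; case: ifP => _; case: ltnP => // h; first by rewrite Fz.
Qed.
Section Operators.
Context {R : realType} {X : completeNormedModType R} (e : nat -> X)
  (N : X -> R) (hN : equivalent_norm N)
  (Nmono : forall m a b, (forall n, (n < m)%N -> `|a n| <= `|b n|) ->
     N (fincomb e m a) <= N (fincomb e m b))
  (e0 : forall n, e n != 0)
  (edense : dense [set x | exists m a, x = fincomb e m a])
  (p : R) (p1 : 1 <= p)
  {W : completeNormedModType R} (E : nat -> nat -> W)
  (Enorm : forall m b,
     `|array E m b| = N (fincomb e m (fun n => lp_norm p m (b n))))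
  (Edense : dense [set x | exists m b, x = array E m b]).

Lemma le_array m b c : (forall n i, box m n i -> `|b n i| <= `|c n i|) ->
  `|array E m b| <= `|array E m c|.
Proof.
move=> bc; rewrite !Enorm; apply: Nmono => n nm.
apply: le_trans (ler_norm _); rewrite [leLHS]normr_lp_norm.
by apply: ler_lp_norm => // i im; apply: bc; rewrite /box nm.
Qed.

Lemma eq_on_units (U : normedModType R) (A B : {linear W -> U}) :
  continuous A -> continuous B -> (forall n i, A (E n i) = B (E n i)) ->
  forall x, A x = B x.
Proof.
move=> Ac Bc AB; apply: (dense_eq Edense Ac Bc) => _ [m [b ->]].
by rewrite !linear_array; apply: eq_bigr => n _; apply: eq_bigr => i _; rewrite AB.
Qed.

Lemma operator_of_units (U : completeNormedModType R) (F : nat -> nat -> U) (C : R) :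
  0 <= C -> (forall m b, `|array F m b| <= C * `|array E m b|) ->
  exists A : {linear W -> U}, (forall x, `|A x| <= C * `|x|) /\
    forall n i, A (E n i) = F n i.
Proof.
move=> C0 FE.
pose G : set (W * U) := [set xy | exists m b, xy = (array E m b, array F m b)].
have [||||A [AC AG]] := @extend_dense _ _ _ G C => //.
- split.
    by exists 0%N, (fun _ _ => 0); rewrite /array !big_ord0.
  move=> t _ _ [m [b ->]] [m' [b' ->]].
  exists (maxn m m'), (fun n i => t * cutoff (box m) b n i + cutoff (box m') b' n i).
  rewrite !arrayZD.
  have wid (V : lmodType R) (H : nat -> nat -> V) k c : (k <= maxn m m')%N ->
      array H (maxn m m') (cutoff (box k) c) = array H k c.
    move=> km; rewrite (array_widen _ km); last exact: supported_cutoff.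
    exact: array_cutoff_box.
  by rewrite !wid ?leq_maxl ?leq_maxr.
- by move=> _ _ [m [b [-> ->]]].
- apply: approx_dense => x d d0; have [_ [m [b ->]] xb] := dense_approx Edense x d0.
  by exists (array E m b) => //; exists (array F m b), m, b.
exists A; split=> // n i; apply: AG; exists (maxn n i).+1, (unit_array R n i).
by rewrite !array_unit// ltnS ?leq_maxl ?leq_maxr.
Qed.

(** Deleting entries of an array decreases its norm: these are the band
projections of W. *)
Lemma band_exists (D : nat -> nat -> bool) : exists A : {linear W -> W},
  (forall x, `|A x| <= `|x|) /\ forall n i, A (E n i) = if D n i then E n i else 0.
Proof.
have [m b|A [AC AE]] := @operator_of_units _ (fun n i => if D n i then E n i else 0) 1 ler01.
  rewrite mul1r -array_cutoff; apply: le_array => n i _; rewrite /cutoff.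
  by case: ifP => // _; rewrite normr0.
by exists A; split=> // x; have := AC x; rewrite mul1r.
Qed.

Definition band D : {linear W -> W} := projT1 (cid (band_exists D)).

Lemma band_le D x : `|band D x| <= `|x|.
Proof. by rewrite /band; case: cid => A [/= AC _]. Qed.

Lemma band_unit D n i : band D (E n i) = if D n i then E n i else 0.
Proof. by rewrite /band; case: cid => A [/= _ AE]. Qed.

Lemma band_continuous D : continuous (band D).
Proof. by apply: (@bounded_continuous _ _ _ _ 1) => x; rewrite mul1r band_le. Qed.

Lemma band_array D m b : band D (array E m b) = array E m (cutoff D b).
Proof.
rewrite linear_array array_cutoff; apply: eq_bigr => n _; apply: eq_bigr => i _.
by rewrite band_unit.
Qed.

Lemma band_complement D x : x - band D x = band (fun n i => ~~ D n i) x.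
Proof.
suff : band (fun n i => ~~ D n i) x + band D x = x by move=> h; rewrite -{1}h addrK.
have [A AE] : exists A : {linear W -> W}, forall x,
    A x = band (fun n i => ~~ D n i) x + band D x.
  by apply: linear_of_function => a u v; rewrite !linearP scalerDr addrACA.
rewrite -AE; apply: (@eq_on_units _ A idfun).
- apply: (@bounded_continuous _ _ _ _ 2) => u; rewrite AE (le_trans (ler_normD _ _))//.
  by rewrite mulr_natl mulr2n lerD// band_le.
- by move=> u; exact: cvg_id.
- by move=> n i; rewrite AE !band_unit /=; case: (D n i); rewrite ?add0r ?addr0.
Qed.

Lemma band_band D D' x : band D (band D' x) = band (fun n i => D n i && D' n i) x.
Proof.
apply: (@eq_on_units _ (band D \o band D')) => [u|u|n i].
- apply: continuous_comp; exact: band_continuous.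
- exact: band_continuous.
- rewrite /= !band_unit; case: (D' n i); rewrite ?andbT ?andbF ?linear0//.
  exact: band_unit.
Qed.

Lemma unit_neq0 n i : E n i != 0.
Proof.
rewrite -normr_gt0; have nM : (n < (maxn n i).+1)%N by rewrite ltnS leq_maxl.
have iM : (i < (maxn n i).+1)%N by rewrite ltnS leq_maxr.
rewrite -(array_unit E nM iM) Enorm.
have -> : fincomb e (maxn n i).+1
    (fun k => lp_norm p (maxn n i).+1 (unit_array R n i k)) = e n.
  rewrite /fincomb (bigD1 (Ordinal nM))//= big1 ?addr0 => [|k]; last first.
    rewrite -val_eqE => /negbTE /= kn.
    rewrite (@eq_lp_norm _ _ _ _ (fun=> 0)) ?lp_norm0 ?scale0r// => j _.
    by rewrite /unit_array kn.
  rewrite (lp_norm_unique p1 (r := 1)) ?scale1r// powR1.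
  rewrite (bigD1 (Ordinal iM))//= /unit_array !eqxx normr1 powR1 big1 ?addr0// => j.
  rewrite -val_eqE => /negbTE /= ->.
  by rewrite normr0 powR0// gt_eqF// (lt_le_trans ltr01).
exact: (equivalent_norm_gt0 hN).
Qed.

Lemma norming_functional (D : nat -> nat -> bool) (w : W) : band D w = w ->
  exists f : {linear W -> R^o}, (forall x, `|f x| <= `|band D x|) /\ f w = `|w|.
Proof.
move=> Dw; have [f [fb fw]] := hahn_banach_norming w.
by exists (f \o band D); split=> [x|] /=; [exact: fb|rewrite Dw].
Qed.

(** It is a norming functional of E n i, restricted to one entry and rescaled. *)
Lemma coordinate_functional n i : exists f : {linear W -> R^o},
  continuous f /\ forall n' i', f (E n' i') = ((n' == n) && (i' == i))%:R.
Proof.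
pose D n' i' := (n' == n) && (i' == i).
have [|f [fb fE]] := @norming_functional D (E n i); first by rewrite band_unit /D !eqxx.
have [g gE] : exists g : {linear W -> R^o}, forall x, g x = `|E n i|^-1 * f x.
  apply: linear_of_function => a x y; rewrite linearP /= mulrDr; congr (_ + _).
  by rewrite /GRing.scale /= mulrCA.
exists g; split.
  apply: (@bounded_continuous _ _ _ _ (`|E n i|^-1)) => x.
  by rewrite gE normrM normfV normr_id ler_wpM2l// (le_trans (fb x))// band_le.
move=> n' i'; rewrite gE; have [|Dni] := boolP (D n' i'); last first.
  have := fb (E n' i'); rewrite band_unit (negbTE Dni) normr0 normr_le0 => /eqP ->.
  by rewrite mulr0 -/(D n' i') (negbTE Dni).
by rewrite /D => /andP[/eqP -> /eqP ->]; rewrite fE !eqxx mulVf// normr_eq0 unit_neq0.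
Qed.

Lemma infinite_dim_lattice_sum : infinite_dim [set: W].
Proof.
have /choice[f fP] : forall i, exists f : {linear W -> R^o},
    forall n' i', f (E n' i') = ((n' == 0) && (i' == i))%:R.
  by move=> i; have [f [_ fP]] := coordinate_functional 0 i; exists f.
apply: (@infinite_dim_biorthogonal _ _ _ (fun i => E 0 i) f) => // j k.
by rewrite fP eqxx eq_sym.
Qed.

(** * Gliding humps *)

(** The hump glides along the levels: Y is assumed to have unit vectors
arbitrarily close to their restriction to high levels in the region S. *)
Section GlidingHump.
Context (lev : nat -> nat -> nat) (S : nat -> nat -> bool) (Y : set W)
  (levP : forall m n i, box m n i -> (lev n i < m)%N)
  (Ylin : linear_subspace Y)
  (Ytail : forall k (d : R), 0 < d -> exists2 y, Y y &
     `|y| = 1 /\ `|y - band (fun n i => S n i && (k <= lev n i)%N) y| < d).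

(** A unit vector y of Y is approximated by a finite array, whose entries
outside the high levels are then deleted; dividing both by the norm of the
array, which is at least 1/2, at most doubles the distance between them. *)
Lemma hump_step k (d : R) : 0 < d -> exists (y : W) (m : nat) (b : nat -> nat -> R),
  [/\ Y y /\ (k < m)%N, supported (box m) b,
      supported (fun n i => S n i && (k <= lev n i)%N) b,
      `|array E m b| = 1 & `|y - array E m b| <= d].
Proof.
move=> d0; pose D n i := S n i && (k <= lev n i)%N.
pose d' := Num.min d 1 / 4.
have m0 : 0 < Num.min d 1 by rewrite lt_min d0 ltr01.
have d'0 : 0 < d' by rewrite divr_gt0.
have d'd : 4 * d' <= d by rewrite /d' mulrC divfK// ge_min lexx.
have d'1 : 4 * d' <= 1 by rewrite /d' mulrC divfK// ge_min lexx orbT.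
have [y Yy [y1 yD]] := Ytail k d'0.
have [_ [m0' [c ->]] yc] := dense_approx Edense y d'0.
pose b0 := cutoff (box m0') (cutoff D c).
pose m := maxn m0' k.+1.
have b0m : supported (box m) b0.
  move=> n i nb; apply: supported_cutoff; apply: contra nb => /andP[h1 h2].
  by rewrite /box !(leq_trans _ (leq_maxl _ _)).
have b0D : supported D b0.
  by move=> n i nD; rewrite /b0 /cutoff (negbTE nD) if_same.
have wE : array E m b0 = band D (array E m0' c).
  rewrite band_array (array_widen _ (leq_maxl _ _)) ?array_cutoff_box//.
  exact: supported_cutoff.
have yw : `|y - array E m b0| < 2 * d'.
  have -> : y - array E m b0 = (y - band D y) + band D (y - array E m0' c).
    by rewrite wE linearB addrA subrK.
  apply: (le_lt_trans (ler_normD _ _)); rewrite mulr_natl mulr2n.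
  apply: ltrD => //; exact: le_lt_trans (band_le _ _) yc.
set w := array E m b0 in wE yw; pose r := `|w|.
have r2 : 2^-1 <= r.
  have : `|y| <= `|y - w| + r by rewrite -{1}(subrK w y) ler_normD.
  by rewrite y1 => h; lra.
have r0 : 0 < r by lra.
exists (r^-1 *: y), m, (fun n i => r^-1 * b0 n i); split.
- split; last exact: leq_maxr.
  by have := Ylin.2 r^-1 _ _ Yy Ylin.1; rewrite addr0.
- by move=> n i /b0m ->; rewrite mulr0.
- by move=> n i /b0D ->; rewrite mulr0.
- by rewrite arrayZ normrZ -/w -/r ger0_norm ?invr_ge0 ?(ltW r0)// mulVf ?gt_eqF.
- rewrite arrayZ -scalerBr normrZ -/w ger0_norm ?invr_ge0 ?(ltW r0)//.
  rewrite mulrC ler_pdivrMr//.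
  have : 2^-1 * d <= r * d by rewrite ler_wpM2r// ltW.
  rewrite [d * r]mulrC; lra.
Qed.

(** The blocks w_k = array E (t k.+1) (b k) are disjoint and close to the
vectors y_k, so functionals norming w_k, restricted to its block, are
biorthogonal, and the perturbation principle carries w_k to y_k. *)
Lemma gliding_hump : exists (t : nat -> nat) (b : nat -> nat -> nat -> R)
    (y : nat -> W) (phi : nat -> {linear W -> R^o}) (T B : {linear W -> W}),
  [/\ forall k, (t k < t k.+1)%N,
      forall k, supported (box (t k.+1)) (b k) /\ supported (block lev S t k) (b k),
      forall k, `|array E (t k.+1) (b k)| = 1,
      forall k x, `|phi k x| <= `|band (block lev S t k) x| &
      forall j k, phi j (array E (t k.+1) (b k)) = (j == k)%:R] /\
  [/\ forall k, Y (y k), forall x, `|T x| <= 2 * `|x|, continuous B,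
      forall x, B (T x) = x & forall k, T (array E (t k.+1) (b k)) = y k].
Proof.
have /choice[G GP] : forall rk : nat * nat, exists ymb : W * nat * (nat -> nat -> R),
  let: (y, m, b) := ymb in
  [/\ Y y /\ (rk.2 < m)%N, supported (box m) b,
      supported (fun n i => S n i && (rk.2 <= lev n i)%N) b,
      `|array E m b| = 1 & `|y - array E m b| <= (2^-1) ^+ rk.1.+2].
  move=> [r k]; have d0 : 0 < (2^-1) ^+ r.+2 :> R by rewrite exprn_gt0.
  by have [y [m [b h]]] := hump_step k d0; exists (y, m, b).
pose t := fix t r := if r is r'.+1 then (G (r', t r')).1.2 else 0%N.
pose b k := (G (k, t k)).2; pose y k := (G (k, t k)).1.1.
have GE k : [/\ Y (y k) /\ (t k < t k.+1)%N, supported (box (t k.+1)) (b k),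
      supported (fun n i => S n i && (t k <= lev n i)%N) (b k),
      `|array E (t k.+1) (b k)| = 1 &
      `|y k - array E (t k.+1) (b k)| <= (2^-1) ^+ k.+2].
  by have := GP (k, t k); rewrite /y /b /=; case: (G (k, t k)) => [[]].
have tS k : (t k < t k.+1)%N by have [[]] := GE k.
have bD k : supported (block lev S t k) (b k).
  move=> n i; have [_ sb sD _ _] := GE k; rewrite /block andbA negb_and => /orP[/sD//|].
  by move=> h; apply: sb; apply: contra h => /levP.
pose w k := array E (t k.+1) (b k).
have wband k : band (block lev S t k) (w k) = w k.
  by rewrite /w band_array cutoff_id.
have /choice[phi phiP] : forall k, exists f : {linear W -> R^o},
    (forall x, `|f x| <= `|band (block lev S t k) x|) /\ f (w k) = `|w k|.
  by move=> k; exact: norming_functional.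
have biorth j k : phi j (w k) = (j == k)%:R.
  have [->|jk] := eqVneq j k; first by rewrite (phiP k).2; case: (GE k).
  apply/normr0_eq0/le_anti; rewrite normr_ge0 andbT.
  apply: (le_trans ((phiP j).1 _)); rewrite /w band_array array0 ?normr0// => n i.
  rewrite /cutoff; case: ifP => // Dj; apply: bD; apply/negP => Dk.
  by move: jk; rewrite (block_disjoint tS Dj Dk) eqxx.
have phib k x : `|phi k x| <= `|x| := le_trans ((phiP k).1 x) (band_le _ x).
have close k : `|y k - w k| <= (2^-1) ^+ k.+2 by case: (GE k).
have [T [B [Tb Bc BT Tw]]] := small_perturbation phib biorth close.
exists t, b, y, phi, T, B; split; split=> // k.
- by split=> //; case: (GE k).
- by case: (GE k).
- by move=> x; exact: (phiP k).1.
- by have [[]] := GE k.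
Qed.

End GlidingHump.

(** * Vectors with late rows *)

Lemma operator_of_basis (U : completeNormedModType R) (F : nat -> U) (C : R) :
  0 <= C -> (forall m a, `|fincomb F m a| <= C * `|fincomb e m a|) ->
  exists A : {linear X -> U}, (forall x, `|A x| <= C * `|x|) /\
    forall m a, A (fincomb e m a) = fincomb F m a.
Proof.
move=> C0 FC.
pose G : set (X * U) := [set xy | exists m a, xy = (fincomb e m a, fincomb F m a)].
have [||||A [AC AG]] := @extend_dense _ _ _ G C => //.
- split; first by exists 0%N, (fun=> 0); rewrite /fincomb !big_ord0.
  move=> t _ _ [m [a ->]] [m' [a' ->]].
  pose cut k (c : nat -> R) n := if (n < k)%N then c n else 0.
  exists (maxn m m'), (fun n => t * cut m a n + cut m' a' n).
  have lin (V : lmodType R) (H : nat -> V) k c c' :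
      fincomb H k (fun n => t * c n + c' n) = t *: fincomb H k c + fincomb H k c'.
    rewrite /fincomb scaler_sumr -big_split /=; apply: eq_bigr => n _.
    by rewrite scalerDl scalerA.
  have wid (V : lmodType R) (H : nat -> V) k c : (k <= maxn m m')%N ->
      fincomb H (maxn m m') (cut k c) = fincomb H k c.
    move=> km; rewrite /fincomb (big_ord_widen _ (fun n => c n *: H n) km).
    rewrite [RHS]big_mkcond /=; apply: eq_bigr => n _; rewrite /cut.
    by case: ifP; rewrite ?scale0r.
  by rewrite !lin !wid ?leq_maxl ?leq_maxr.
- by move=> _ _ [m [a [-> ->]]].
- apply: approx_dense => x d d0; have [_ [m [a ->]] xb] := dense_approx edense x d0.
  by exists (fincomb e m a) => //; exists (fincomb F m a), m, a.
exists A; split=> // m a; apply: AG; by exists m, a.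
Qed.

(** Each row is evaluated by a functional of norm at most one on l_p, which
decreases the vector of the row norms coordinatewise. *)
Lemma rowwise_functional (g : nat -> nat -> R) :
  (forall n m (b : nat -> R), `|\sum_(i < m) g n i * b i| <= lp_norm p m b) ->
  exists q : {linear W -> X}, continuous q /\ forall m b,
    q (array E m b) = fincomb e m (fun n => \sum_(i < m) g n i * b n i).
Proof.
move=> gb; have [_ _ [c [C [c0 C0 NC]]]] := hN.
pose F n i := g n i *: e n.
have FE m b : array F m b = fincomb e m (fun n => \sum_(i < m) g n i * b n i).
  apply: eq_bigr => n _; rewrite scaler_suml; apply: eq_bigr => i _.
  by rewrite /F scalerA mulrC.
have ci : 0 <= c^-1 by rewrite invr_ge0 ltW.
have [m b|q [qb qE]] := @operator_of_units _ F c^-1 ci.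
  rewrite FE Enorm mulrC ler_pdivlMr// mulrC (le_trans (NC _).1)//.
  by apply: Nmono => n _; rewrite [leRHS]normr_lp_norm.
exists q; split; first exact: bounded_continuous qb.
move=> m b; rewrite linear_array -FE; apply: eq_bigr => n _.
by apply: eq_bigr => i _; rewrite qE.
Qed.

(** Each basis vector goes to a row vector of l_p norm at most one, so the
vector of row norms of an image is dominated by the coefficients. *)
Lemma rowwise_placement (L : nat -> nat) (f : nat -> nat -> R) :
  (forall n, lp_norm p (L n) (f n) <= 1) ->
  exists j : {linear X -> W}, continuous j /\ forall m a, j (fincomb e m a) =
    \sum_(n < m) a n *: \sum_(i < L n) f n i *: E n i.
Proof.
move=> fb; have [_ _ [c [C [c0 C0 NC]]]] := hN.
have [m a|j [jb jE]] := @operator_of_basis _ (fun n => \sum_(i < L n) f n i *: E n i) C (ltW C0); last first.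
  by exists j; split; first exact: bounded_continuous jb.
apply: le_trans (NC _).2.
pose M := maxn m (\max_(n < m) L n).
have LM (n : 'I_m) : (L n <= M)%N.
  by apply: leq_trans (leq_maxr _ _); exact: (leq_bigmax n).
pose b n i := if (n < m)%N && (i < L n)%N then a n * f n i else 0.
have -> : fincomb (fun n => \sum_(i < L n) f n i *: E n i) m a = array E M b.
  rewrite /fincomb (big_ord_widen _ (fun n => a n *: \sum_(i < L n) f n i *: E n i) (leq_maxl m (\max_(n < m) L n))).
  rewrite big_mkcond /=; apply: eq_bigr => n _; rewrite /b; case: ltnP => [nm|mn].
    rewrite /= (big_ord_widen _ (fun i => f n i *: E n i) (LM (Ordinal nm))).
    rewrite scaler_sumr big_mkcond /=; apply: eq_bigr => i _.
    by case: ifP => _; rewrite ?scalerA// scale0r.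
  by rewrite big1// => i _; rewrite scale0r.
rewrite Enorm.
have -> : fincomb e m a = fincomb e M (fun n => if (n < m)%N then a n else 0).
  rewrite /fincomb (big_ord_widen _ (fun n => a n *: e n) (leq_maxl m (\max_(n < m) L n))).
  by rewrite big_mkcond /=; apply: eq_bigr => n _; case: ifP; rewrite ?scale0r.
apply: Nmono => n _; rewrite normr_lp_norm /b; case: ltnP => [nm|mn] /=.
  have -> : lp_norm p M (fun i => if (i < L n)%N then a n * f n i else 0) =
      lp_norm p (L n) (fun i => a n * f n i).
    transitivity (lp_norm p (L n) (fun i => if (i < L n)%N then a n * f n i else 0)).
      apply: lp_norm_widen => //; first exact: (LM (Ordinal nm)).
      by move=> i; rewrite ltnNge => ->.
    by apply: eq_lp_norm => // i ->.
  by rewrite lp_normZ// ler_piMr.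
by rewrite lp_norm0// normr0.
Qed.

(** All the w_k lie in the range of one rowwise operator j of X, because
their blocks of rows are disjoint; this carries the complemented subspace from
X to W. *)
Lemma complemented_late_rows (Y : set W) : subprojective X ->
  closed Y -> linear_subspace Y ->
  (forall k (d : R), 0 < d -> exists2 y, Y y &
     `|y| = 1 /\ `|y - band (fun n _ => (k <= n)%N) y| < d) ->
  exists Z : set W,
    [/\ Z `<=` Y, closed Z, linear_subspace Z, infinite_dim Z & complemented Z].
Proof.
move=> [_ Xsub] Yc Ylin Ytail.
have [t [b [y [phi [T [B [[tS bS w1 phib biorth] [Yy Tb Bc BT Tw]]]]]]]] :=
  @gliding_hump (fun n _ => n) (fun _ _ => true) Y
    (fun m n i h => proj1 (andP h)) Ylin Ytail.
set D := block _ _ t in bS phib.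
pose w k := array E (t k.+1) (b k).
(* ka n is the block that contains the row n, if there is one *)
have /choice[ka kaP] : forall n, exists k0, forall k,
    (t k <= n)%N && (n < t k.+1)%N -> k = k0.
  move=> n; have [[k0 k0P]|no] := pselect (exists k, (t k <= n)%N && (n < t k.+1)%N).
    exists k0 => k kP; exact: (@block_disjoint (fun n _ => n) (fun _ _ => true) t tS _ _ n 0).
  by exists 0%N => k kP; case: no; exists k.
pose L n := t (ka n).+1; pose be n := b (ka n) n.
have /choice[g gP] : forall n, exists g : nat -> R,
    (forall m (b : nat -> R), `|\sum_(i < m) g i * b i| <= lp_norm p m b) /\
    \sum_(i < L n) g i * be n i = lp_norm p (L n) (be n).
  by move=> n; exact: (norming_sequence p1).
have [q [qc qE]] := rowwise_functional (fun n => (gP n).1).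
pose f n i := (lp_norm p (L n) (be n))^-1 * be n i.
have [n|j [jc jE]] := @rowwise_placement L f.
  rewrite /f lp_normZ// normfV (ger0_norm (lp_norm_ge0 _ _ _)).
  have [->|r0] := eqVneq (lp_norm p (L n) (be n)) 0; first by rewrite mulr0 ler01.
  by rewrite mulVf.
pose z k := fincomb e (t k.+1) (fun n => lp_norm p (t k.+1) (b k n)).
have b0 k n : (n < t k)%N -> b k n = (fun=> 0).
  move=> nt; apply/funext => i; have [_ bD] := bS k; apply: bD.
  by rewrite /D /block /= leqNgt nt.
have Lk k n : (t k <= n)%N -> (n < t k.+1)%N -> ka n = k.
  by move=> h1 h2; apply/esym/kaP; rewrite h1.
have jz k : j (z k) = w k.
  rewrite jE /w /array; apply: eq_bigr => n _.
  have [nt|tn] := ltnP n (t k).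
    rewrite b0// lp_norm0// scale0r big1// => i _.
    by rewrite scale0r.
  rewrite /L /f /be /L (Lk _ _ tn (ltn_ord n)) scaler_sumr.
  apply: eq_bigr => i _; rewrite scalerA mulrA.
  have [r0|r0] := eqVneq (lp_norm p (t k.+1) (b k n)) 0.
    have := le_lp_norm p1 (b k n) (ltn_ord i); rewrite r0 normr_le0 => /eqP ->.
    by rewrite mulr0.
  by rewrite mulfV// mul1r.
have qw k : q (w k) = z k.
  rewrite /w qE /z; apply: eq_bigr => n _; congr (_ *: _).
  have [nt|tn] := ltnP n (t k).
    by rewrite b0// lp_norm0// big1// => i _; rewrite mulr0.
  by have := (gP n).2; rewrite /L /be (Lk _ _ tn (ltn_ord n)).
have Tc : continuous T by exact: bounded_continuous Tb.
(* q j x = x makes T j injective on Y0, with left inverse q B *)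
pose Y0 := [set x | Y (T (j x)) /\ q (j x) = x].
have Y0z k : Y0 (z k).
  by rewrite /Y0 /mkset jz qw; split=> //; rewrite /w Tw.
have Y0c : closed Y0.
  apply: closedI.
    apply: (@preimage_closed _ _ (T \o j)) => // x _.
    by apply: continuous_comp; [exact: jc|exact: Tc].
  apply: (@closed_coincidence _ _ _ (q \o j) idfun) => x; last exact: cvg_id.
  by apply: continuous_comp; [exact: jc|exact: qc].
have Y0lin : linear_subspace Y0.
  split; first by rewrite /Y0 /mkset !linear0; split=> //; exact: Ylin.1.
  move=> a u v [Yu qu] [Yv qv]; rewrite /Y0 /mkset !linearP qu qv; split=> //.
  exact: Ylin.2.
have Y0inf : infinite_dim Y0.
  apply: (@infinite_dim_biorthogonal _ _ _ z (fun k => phi k \o j)) => // i k /=.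
  by rewrite jz biorth.
have [Z0 [ZY Zc Zlin Zinf [P [Pc PZ Pid]]]] := Xsub Y0 Y0c Y0lin Y0inf.
have qBTj x : Z0 x -> q (B (T (j x))) = x by move=> /ZY[_ qj]; rewrite BT.
apply: (@complemented_of_projection _ _ _ (T \o (j \o (P \o (q \o B))))).
- move=> x; apply: continuous_comp; last exact: Tc.
  apply: continuous_comp; last exact: jc.
  apply: continuous_comp; last exact: Pc.
  by apply: continuous_comp; [exact: Bc|exact: qc].
- move=> x /=; have Zx := PZ (q (B x)).
  by rewrite (qBTj _ Zx) (Pid _ Zx).
- by move=> x /=; case: (ZY _ (PZ (q (B x)))).
- move=> /(finitely_spanned_image (q \o B)) [m [v vP]]; apply: Zinf.
  exists m, v => x Zx; apply: vP; exists (T (j x)); last by rewrite /= (qBTj _ Zx).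
  by exists (T (j x)) => //=; rewrite (qBTj _ Zx) (Pid _ Zx).
Qed.

(** * Vectors determined by early rows *)

Section EarlyRows.
Context (n0 : nat).

(** On the rows before n0, the norms of the finitely many rows determine both
the norm of W and the l_p norm of all entries up to constants. *)
Lemma first_rows_estimates : exists A B : R, [/\ 0 <= A, 0 <= B,
  forall m b, (forall n i, (n0 <= n)%N -> b n i = 0) ->
    `|array E m b| `^ p <= A * power_mass p m b &
  forall m b, (forall n i, (n0 <= n)%N -> b n i = 0) ->
    power_mass p m b <= B * `|array E m b| `^ p].
Proof.
have p0 : 0 < p := lt_le_trans ltr01 p1.
have [_ NZ _] := hN.
have Ne n : 0 < N (e n) := equivalent_norm_gt0 hN (e0 n).
have row0 m b n : (forall n i, (n0 <= n)%N -> b n i = 0) -> (n0 <= n)%N ->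
    lp_norm p m (b n) = 0.
  move=> b0 nn; rewrite -(lp_norm0 p1 m); apply: eq_lp_norm => // i _.
  by rewrite b0.
exists ((\sum_(n < n0) N (e n)) `^ p), (\sum_(n < n0) (N (e n) `^ p)^-1); split.
- exact: powR_ge0.
- by apply: sumr_ge0 => n _; rewrite invr_ge0 powR_ge0.
- move=> m b b0; have rho0 := powR_ge0 (power_mass p m b) p^-1.
  rewrite -[X in _ * X](powRpK p1 (power_mass_ge0 p m b)) -powRM//; last first.
    by apply: sumr_ge0 => n _; exact: ltW.
  rewrite le_powR//; last first.
    by rewrite mulr_ge0//; apply: sumr_ge0 => n _; exact: ltW.
  rewrite Enorm.
  apply: le_trans (@equivalent_norm_sum _ _ N hN m (fun n => lp_norm p m (b n) *: e n)) _.
  under eq_bigr do rewrite NZ normr_lp_norm.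
  pose F n := if (n < n0)%N then N (e n) * power_mass p m b `^ p^-1 else 0.
  have F0 n : 0 <= F n by rewrite /F; case: ifP => // _; rewrite mulr_ge0// ltW.
  apply: (@le_trans _ _ (\sum_(n < m) F n)).
    apply: ler_sum => n _; rewrite /F; case: ltnP => nn; last by rewrite row0// mul0r.
    rewrite mulrC ler_wpM2l ?(ltW (Ne _))// -(le_powR p1 (lp_norm_ge0 _ _ _) rho0).
    rewrite powRpK ?power_mass_ge0// (power_mass_rows p1) (bigD1 n)//= lerDl.
    by apply: sumr_ge0 => k _; exact: powR_ge0.
  apply: (le_trans (ler_sum_first m F0 _)) => [n nn|].
    by rewrite /F ltnNge nn.
  rewrite mulr_suml; apply: ler_sum => n _; by rewrite /F ltn_ord.
- move=> m b b0; rewrite (power_mass_rows p1).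
  pose F n := if (n < n0)%N then (N (e n) `^ p)^-1 * `|array E m b| `^ p else 0.
  have F0 n : 0 <= F n.
    by rewrite /F; case: ifP => // _; rewrite mulr_ge0 ?invr_ge0 ?powR_ge0.
  apply: (@le_trans _ _ (\sum_(n < m) F n)).
    apply: ler_sum => n _; rewrite /F; case: ltnP => nn; last first.
      by rewrite row0// powR0// gt_eqF.
    rewrite mulrC ler_pdivlMr ?powR_gt0// -(powRM p (lp_norm_ge0 p m (b n)) (ltW (Ne n))).
    rewrite (le_powR p1 (mulr_ge0 (lp_norm_ge0 p m (b n)) (ltW (Ne n))) (normr_ge0 _)) Enorm.
    rewrite -{1}(normr_lp_norm p m (b n)) -NZ.
    have -> : lp_norm p m (b n) *: e n =
        fincomb e m (fun k => if k == n then lp_norm p m (b n) else 0).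
      rewrite /fincomb (bigD1 n)//= eqxx big1 ?addr0// => k.
      by rewrite -val_eqE => /negbTE ->; rewrite scale0r.
    apply: Nmono => k _; case: eqP => [->//|_].
    by rewrite normr0.
  apply: (le_trans (ler_sum_first m F0 _)) => [n nn|].
    by rewrite /F ltnNge nn.
  rewrite mulr_suml; apply: ler_sum => n _; by rewrite /F ltn_ord.
Qed.

Section BoundedBelow.
Let first_rows n (_ : nat) := (n < n0)%N.
Let Q := band first_rows.
Context (Y : set W) (c : R) (Ycl : closed Y) (Ylin : linear_subspace Y)
  (Yinf : infinite_dim Y) (c0 : 0 < c) (Qc : forall y, Y y -> c * `|y| <= `|Q y|).

(** The n0 * k coordinate functionals of the first k columns have a common
zero y in Y; their linear combination with the unit vectors is the part of Q y
in these columns, which therefore vanishes. *)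
Lemma vector_in_late_columns k : exists2 y, Y y &
  y != 0 /\ band (fun n i => first_rows n i && (k <= i)%N) y = Q y.
Proof.
have /choice[f fP] : forall ni : nat * nat, exists f : {linear W -> R^o},
    continuous f /\ forall n' i', f (E n' i') = ((n' == ni.1) && (i' == ni.2))%:R.
  by move=> [n i]; exact: coordinate_functional.
have [y Yy [y0 fy]] :=
  (* the positions in n0 rows and k columns are enumerated by r < n0 * k *)
  infinite_dim_kernel (fun r => f (r %/ k, r %% k)%N) (n0 * k) Ylin Yinf.
exists y => //; split=> //; set D := (X in band X).
have fy0 n i : (n < n0)%N -> (i < k)%N -> f (n, i) y = 0.
  move=> nn ik; have k0 : (0 < k)%N := leq_ltn_trans (leq0n _) ik.
  have := fy (n * k + i)%N.
  rewrite divnMDl// divn_small// addn0 modnMDl modn_small//; apply.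
  by rewrite (@leq_trans (n.+1 * k))// ?leq_mul2r ?nn ?orbT// mulSn addnC ltn_add2r.
(* A u is Q u split into its late columns and its first k columns *)
have [A AE] : exists A : {linear W -> W}, forall u,
    A u = band D u + \sum_(n < n0) \sum_(i < k) f (n : nat, i : nat) u *: E n i.
  apply: linear_of_function => a u v; rewrite !linearP scalerDr addrACA; congr (_ + _).
  rewrite scaler_sumr -big_split /=; apply: eq_bigr => n _.
  rewrite scaler_sumr -big_split /=; apply: eq_bigr => i _.
  by rewrite linearP scalerDl scalerA.
have /choice[C CP] : forall ni : nat * nat, exists C : R,
    forall u, `|f ni u| <= C * `|u|.
  by move=> ni; have [C _ CP] := continuous_bounded (fP ni).1; exists C.
have -> : Q y = A y.
  apply: eq_on_units => [u||n i]; first exact: band_continuous.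
    apply: (@bounded_continuous _ _ _ _
      (1 + \sum_(n < n0) \sum_(i < k) C (n : nat, i : nat) * `|E n i|)) => u.
    rewrite AE (le_trans (ler_normD _ _))// mulrDl mul1r lerD ?band_le// mulr_suml.
    apply: (le_trans (ler_norm_sum _ _ _)); apply: ler_sum => n _; rewrite mulr_suml.
    apply: (le_trans (ler_norm_sum _ _ _)); apply: ler_sum => i _.
    by rewrite normrZ mulrAC ler_wpM2r.
  rewrite AE !band_unit /D /first_rows.
  have cellE (n' : nat) (i' : nat) : f (n', i') (E n i) *: E n' i' =
      if (n' == n) && (i' == i) then E n i else 0.
    rewrite (fP _).2 /= [n == _]eq_sym [i == _]eq_sym.
    case: andP => [[/eqP -> /eqP ->]|_]; by rewrite ?scale1r ?scale0r.
  under eq_bigr => n' _ do under eq_bigr => i' _ do rewrite cellE.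
  have [nn|nn] := ltnP n n0; last first.
    rewrite big1 ?addr0// => n' _; rewrite big1// => i' _.
    by rewrite ltn_eqF// (leq_trans (ltn_ord n')).
  rewrite /= (bigD1 (Ordinal nn))//= [X in _ + (_ + X)]big1 ?addr0; last first.
    move=> n'; rewrite -val_eqE => /negbTE /= ->.
    by rewrite big1.
  have [ki|ik] := leqP k i.
    rewrite big1 ?addr0// => i' _; rewrite [_ == i]ltn_eqF ?andbF//.
    exact: leq_trans (ltn_ord i') ki.
  rewrite (bigD1 (Ordinal ik))//= !eqxx big1 ?addr0 ?add0r// => i'.
  by rewrite -val_eqE => /negbTE /= ->.
rewrite AE big1 ?addr0// => n _; rewrite big1// => i _.
by rewrite fy0 ?scale0r.
Qed.

Lemma image_tail k (d : R) : 0 < d -> exists2 y, (Q @` Y) y &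
  `|y| = 1 /\ `|y - band (fun n i => first_rows n i && (k <= i)%N) y| < d.
Proof.
move=> d0; have [y Yy [y0 yk]] := vector_in_late_columns k.
have r0 : 0 < `|Q y|.
  by apply: lt_le_trans (Qc Yy); rewrite mulr_gt0// normr_gt0.
exists (`|Q y|^-1 *: Q y).
  exists (`|Q y|^-1 *: y); last by rewrite linearZ.
  by have := Ylin.2 (`|Q y|^-1) _ _ Yy Ylin.1; rewrite addr0.
split; first by rewrite normrZ normfV normr_id mulVf// gt_eqF.
rewrite linearZ /= /Q band_band -/Q.
have -> : (fun n i => first_rows n i && (k <= i)%N && first_rows n i) =
    (fun n i => first_rows n i && (k <= i)%N).
  by apply/funext => n; apply/funext => i; rewrite andbAC andbb.
by rewrite yk subrr normr0.
Qed.

(** The projection onto a block sequence of l_p: the powers |phi_k(u)|^p are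
dominated by the masses of u on the disjoint blocks, hence their sum by the
mass of u, and it dominates the mass of sum_k phi_k(u) w_k. *)
Lemma block_image_bound (t : nat -> nat) (b : nat -> nat -> nat -> R)
    (phi : nat -> {linear W -> R^o}) :
  let D := block (fun _ i => i) first_rows t in
  (forall k, (t k < t k.+1)%N) ->
  (forall k, supported (box (t k.+1)) (b k) /\ supported (D k) (b k)) ->
  (forall k, `|array E (t k.+1) (b k)| = 1) ->
  (forall k x, `|phi k x| <= `|band (D k) x|) ->
  exists2 C : R, 0 <= C & forall m be,
    `|\sum_(k < m) phi k (array E m be) *: array E (t k.+1) (b k)| <=
    C * `|array E m be|.
Proof.
move=> D tS bS w1 phib; have p0 : 0 < p := lt_le_trans ltr01 p1.
have [A [B [A0 B0 upper lower]]] := first_rows_estimates.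
have C0 : 0 <= A * B * (A * B) by rewrite !mulr_ge0.
exists ((A * B * (A * B)) `^ p^-1); first exact: powR_ge0.
move=> m be; set u := array E m be; pose a k : R := phi k u.
have tm := increasing_leq tS.
have bz k n i : (n0 <= n)%N -> b k n i = 0.
  by move=> nn; have [_] := bS k; apply; rewrite /D /block /first_rows ltnNge nn.
have -> : \sum_(k < m) phi k u *: array E (t k.+1) (b k) =
    array E (t m) (fun n i => \sum_(k < m) a k * b k n i).
  rewrite array_sum; apply: eq_bigr => k _; congr (_ *: _); apply/esym.
  by apply: array_widen; [exact: tm|exact: (bS k).1].
rewrite -(le_powR p1) ?mulr_ge0 ?powR_ge0// powRM ?powR_ge0// powRpK//.
apply: (@le_trans _ _ (A * (B * \sum_(k < m) `|a k| `^ p))).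
  apply: le_trans (upper _ _ _) _ => [n i nn|].
    by rewrite big1// => k _; rewrite bz// mulr0.
  rewrite ler_wpM2l// mulr_sumr.
  apply: (@le_trans _ _ (\sum_(k < m) `|a k| `^ p * power_mass p (t m) (b k))).
    rewrite /power_mass; under [leRHS]eq_bigr do rewrite mulr_sumr.
    rewrite [leRHS]exchange_big /=; apply: ler_sum => n _.
    under [leRHS]eq_bigr do rewrite mulr_sumr.
    rewrite [leRHS]exchange_big /=; apply: ler_sum => i _.
    apply: le_trans (@power_sum_disjoint _ _ p1 (fun k => a k * b k n i) m _) _.
      move=> j k xj xk; apply: (@block_disjoint (fun _ i => i) first_rows t tS _ _ n i).
        by apply: contraR xj => /(bS j).2 ->; rewrite mulr0.
      by apply: contraR xk => /(bS k).2 ->; rewrite mulr0.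
    by apply: ler_sum => k _; rewrite normrM powRM.
  apply: ler_sum => k _; rewrite mulrC ler_wpM2r ?powR_ge0//.
  apply: le_trans (lower _ _ (bz k)) _.
  by rewrite (array_widen E (tm _ _ (ltn_ord k)) (bS k).1) w1 powR1 mulr1.
rewrite -!mulrA ler_wpM2l// ler_wpM2l//.
apply: (@le_trans _ _ (A * power_mass p m (cutoff first_rows be))).
  apply: (@le_trans _ _ (\sum_(k < m) A * power_mass p m (cutoff (D k) be))).
    apply: ler_sum => k _; apply: le_trans (upper _ _ _).
      rewrite le_powR// (le_trans (phib k u))// /u band_array//.
    move=> n i nn; rewrite /cutoff /D /block /first_rows ltnNge nn //.
  rewrite -mulr_sumr ler_wpM2l// /power_mass.
  rewrite exchange_big /=; apply: ler_sum => n _.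
  rewrite exchange_big /=; apply: ler_sum => i _.
  have [[k Dk]|no] := pselect (exists k : 'I_m, D k n i).
    rewrite (bigD1 k)//= big1 ?addr0 => [|j jk].
      by rewrite /cutoff Dk; have /and3P[-> _ _] := Dk.
    rewrite /cutoff; case: ifP => [Dj|_]; last by rewrite normr0 powR0// gt_eqF.
    by move: jk; rewrite -val_eqE /= (block_disjoint tS Dj Dk) eqxx.
  rewrite big1 ?powR_ge0// => k _; rewrite /cutoff; case: ifP => [Dk|_].
    by case: no; exists k.
  by rewrite normr0 powR0// gt_eqF.
rewrite ler_wpM2l//; apply: le_trans (lower _ _ _) _.
  by move=> n i nn; rewrite /cutoff /first_rows ltnNge nn.
rewrite ler_wpM2l// le_powR// -band_array; exact: band_le.
Qed.

(** K is the operator u |-> sum_k phi_k(u) y_k. It is bounded because Q is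
bounded below on Y and maps sum_k phi_k(u) y_k to T (sum_k phi_k(u) w_k). As B
Q y_k = w_k and K w_k = y_k, the operator K B Q is a projection. *)
Lemma complemented_early_rows : exists Z : set W,
  [/\ Z `<=` Y, closed Z, linear_subspace Z, infinite_dim Z & complemented Z].
Proof.
have QYlin : linear_subspace (Q @` Y).
  split; first by exists 0; [exact: Ylin.1|rewrite linear0].
  move=> a _ _ [x Yx <-] [y Yy <-]; exists (a *: x + y); last by rewrite linearP.
  exact: Ylin.2.
have [t [b [y' [phi [T [B [[tS bS w1 phib biorth] [Yy' Tb Bc BT Tw]]]]]]]] :=
  @gliding_hump (fun _ i => i) first_rows (Q @` Y)
    (fun m n i h => proj2 (andP h)) QYlin image_tail.
have [C C0 CP] := block_image_bound tS bS w1 phib.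
set D := block _ _ t in bS phib.
pose w k := array E (t k.+1) (b k).
have /choice[y yP] : forall k, exists y, Y y /\ Q y = y' k.
  by move=> k; have [y Yy yE] := Yy' k; exists y.
have phi0 k n i : (i < k)%N -> phi k (E n i) = 0.
  move=> ik; apply/normr0_eq0/le_anti; rewrite normr_ge0 andbT.
  apply: (le_trans (phib _ _)); rewrite band_unit ifF ?normr0//.
  rewrite /D /block [(t k <= i)%N]leqNgt.
  by rewrite (leq_trans ik (increasing_ge tS k)) andbF.
(* phi k (E n i) vanishes for k > i, so these terms are all there are *)
pose F n i := \sum_(k < i.+1) phi k (E n i) *: y k.
have FE m be : array F m be = \sum_(k < m) phi k (array E m be) *: y k.
  under [RHS]eq_bigr => k _.
    rewrite linear_array /array scaler_suml.
    under eq_bigr do rewrite scaler_suml.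
    over.
  rewrite exchange_big /=; apply: eq_bigr => n _.
  rewrite exchange_big /=; apply: eq_bigr => i _.
  rewrite /F scaler_sumr (big_ord_widen _ (fun k => be n i *: (phi k (E n i) *: y k)) (ltn_ord i)).
  rewrite big_mkcond /=; apply: eq_bigr => k _; case: ltnP => ik.
    by rewrite scalerA.
  by rewrite phi0// scaler0 scale0r.
have Ysum m (a : nat -> R) : Y (\sum_(k < m) a k *: y k).
  elim: m => [|m IH]; first by rewrite big_ord0; exact: Ylin.1.
  by rewrite big_ord_recr /= addrC; apply: Ylin.2 => //; exact: (yP m).1.
have KC : 0 <= c^-1 * (2 * C) by rewrite !mulr_ge0 ?invr_ge0 ?(ltW c0).
have [m be|K [Kb KE]] := @operator_of_units _ F _ KC.
  rewrite FE -mulrA ler_pdivlMl//.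
  apply: (le_trans (Qc (Ysum m (fun k => phi k (array E m be))))).
  have -> : Q (\sum_(k < m) phi k (array E m be) *: y k) =
      T (\sum_(k < m) phi k (array E m be) *: w k).
    rewrite !linear_sum; apply: eq_bigr => k _; rewrite !linearZ /=.
    by rewrite (yP k).2 /w Tw.
  apply: (le_trans (Tb _)); rewrite -mulrA ler_wpM2l//; exact: CP.
have Ka m be : K (array E m be) = \sum_(k < m) phi k (array E m be) *: y k.
  rewrite -FE linear_array; apply: eq_bigr => n _; apply: eq_bigr => i _.
  by rewrite KE.
have Kc : continuous K := bounded_continuous Kb.
have Kw k : K (w k) = y k.
  rewrite Ka; have kt : (k < t k.+1)%N := increasing_ge tS k.+1.
  rewrite (bigD1 (Ordinal kt))//= biorth eqxx scale1r big1 ?addr0// => j.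
  by rewrite -val_eqE biorth => /negbTE /= ->; rewrite scale0r.
have KBQ k : K (B (Q (y k))) = y k by rewrite (yP k).2 -Tw BT Kw.
have Pc : continuous (K \o (B \o Q)).
  move=> x; apply: continuous_comp; last exact: Kc.
  by apply: continuous_comp; [exact: band_continuous|exact: Bc].
have PK x : K (B (Q (K x))) = K x.
  apply: (@eq_on_units _ (K \o (B \o (Q \o K))) K) => [|//|n i].
    by move=> z; apply: (@continuous_comp _ _ _ K (K \o (B \o Q))); [exact: Kc|exact: Pc].
  rewrite /= KE /F !linear_sum; apply: eq_bigr => k _.
  by rewrite !linearZ /= KBQ.
apply: (@complemented_of_projection _ _ _ (K \o (B \o Q))) => //.
- by move=> x /=; rewrite PK.
- move=> x; apply: (@dense_closed _ _ _ (K @^-1` Y) Edense).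
    by apply: preimage_closed => // z _; exact: Kc.
  move=> _ [m [be ->]]; rewrite /preimage /mkset Ka.
  exact: (Ysum m (fun k => phi k (array E m be))).
- apply: (@infinite_dim_biorthogonal _ _ _ y (fun k => phi k \o (B \o Q))) => [k|j k].
    by exists (y k) => //=; rewrite KBQ.
  by rewrite /= (yP k).2 -Tw BT biorth.
Qed.

End BoundedBelow.

End EarlyRows.

(** * Subprojectivity of W *)

Lemma subprojective_lattice_sum : subprojective X -> subprojective W.
Proof.
move=> Xsub; split; first exact: infinite_dim_lattice_sum.
move=> Y Yc Ylin Yinf.
have [tail|notail] := pselect (forall k (d : R), 0 < d -> exists2 y, Y y &
    `|y| = 1 /\ `|y - band (fun n _ => (k <= n)%N) y| < d).
  exact: complemented_late_rows.
have [k [d [d0 kd]]] : exists k (d : R), 0 < d /\ forall y, Y y -> `|y| = 1 ->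
    d <= `|band (fun n _ => (n < k)%N) y|.
  apply: contrapT => none; apply: notail => k d d0.
  apply: contrapT => noy; apply: none; exists k, d; split=> // y Yy y1.
  rewrite leNgt; apply/negP => yd; apply: noy; exists y => //; split=> //.
  rewrite band_complement; congr (`|band _ _| < _) : yd.
  by apply/funext => n; apply/funext => i; rewrite -ltnNge.
apply: (@complemented_early_rows k Y d) => // y Yy.
have [->|y0] := eqVneq y 0; first by rewrite normr0 mulr0.
have ny : 0 < `|y| by rewrite normr_gt0.
have Yv : Y (`|y|^-1 *: y) by have := Ylin.2 (`|y|^-1) _ _ Yy Ylin.1; rewrite addr0.
have := kd _ Yv; rewrite linearZ /= !normrZ normfV normr_id mulVf ?gt_eqF//.
by move=> /(_ erefl); rewrite mulrC ler_pdivlMr.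
Qed.

End Operators.

Theorem proposition7p1 (R : realType) (X : completeNormedModType R)
    (e : nat -> X) (N : X -> R) (p : R) (W : completeNormedModType R)
    (hsub : subprojective X) (hsep : separable X)
    (he : unconditional_basis e)
    (hN : equivalent_norm N) (hlat : lattice_norm e N)
    (hp : 1 <= p)
    (hW : is_completion (Xlp_norm e N p) W) :
  subprojective W.
Proof.
have [J [JN Jd]] := hW; have [sb _] := he.
apply: (@subprojective_lattice_sum R X e N hN _ _ _ p hp W (fun n i => J (single i (e n)))) => //.
- by move=> m a b; exact: lattice_norm_fincomb.
- exact: basis_neq0.
- exact: fincomb_dense.
- by move=> m b; exact: (norm_array sb hN hlat hp JN).
- exact: (array_dense sb hN hlat hp JN Jd).
Qed.
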